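(* For every positive constant $b$ there exists a constant $c_b$, depending only on $b$, such that the following holds. Let $\Gamma_1,\Gamma_2,\Gamma_3$ be finite collections of real algebraic curves in $\mathbb{R}^3$, each of degree at most $b$, and let $J$ be the set of multijoints formed by $\Gamma_1,\Gamma_2$ and $\Gamma_3$. Then $$|J|\leq c_b\cdot (|\Gamma_1||\Gamma_2||\Gamma_3|)^{1/2}.$$
   Context: A real (resp. complex) algebraic set is the set of common zeros in $\mathbb{R}^n$ (resp. $\mathbb{C}^n$) of finitely many polynomials with real (resp. complex) coefficients; it is irreducible if it is not a union of two non-empty algebraic sets that are proper subsets of it. The dimension of an irreducible algebraic set $V\subseteq\mathbb{K}^n$ is the transcendence degree over $\mathbb{K}$ of $\mathbb{K}[x_1,\dots,x_n]/I(V)$, where $I(V)$ is the ideal of polynomials vanishing on $V$; the dimension of an algebraic set is the maximal dimension of the irreducible varieties contained in it. An algebraic curve is an algebraic set of dimension 1. The degree of a complex algebraic curve in $\mathbb{C}^n$ is the number of points, counted with appropriate multiplicities, in which a generic hyperplane intersects it; the degree of a real algebraic curve in $\mathbb{R}^n$ is the degree of the smallest complex algebraic curve in $\mathbb{C}^n$ containing it. Let $\mathcal{F}$ be the family of all non-empty sets $\gamma\subseteq\mathbb{R}^3$ such that for every $x\in\gamma$ a basic neighbourhood of $x$ in $\gamma$ is either $\{x\}$ or a finite union of parametrised curves, each homeomorphic to a semi-open line segment with one endpoint the point $x$. If there is a parametrisation $f:[0,1)\to\mathbb{R}^3$ of one of these curves with $f(0)=x$ and $f'(0)\neq 0$, then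 the line through $x$ with direction $f'(0)$ is said to be tangent to $\gamma$ at $x$. Real algebraic curves in $\mathbb{R}^3$ belong to $\mathcal{F}$. For $\Gamma\subset\mathcal{F}$, $T_x^{\Gamma}$ denotes the set of directions of all tangent lines at $x$ to the sets of $\Gamma$ passing through $x$. A point $x\in\mathbb{R}^3$ is a multijoint for (formed by) collections $\Gamma_1,\Gamma_2,\Gamma_3\subset\mathcal{F}$ if $x$ belongs to at least one of the sets in $\Gamma_i$ for all $i=1,2,3$, and there exists at least one vector $v_i\in T_x^{\Gamma_i}$ for each $i=1,2,3$ such that $\{v_1,v_2,v_3\}$ spans $\mathbb{R}^3$. *)

(* Defs.v *)
From HB Require Import structures.
From mathcomp Require Import all_boot all_order all_algebra.
From mathcomp Require Import finmap complex.
From mathcomp Require Import boolp classical_sets functions cardinality.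
From mathcomp Require Import set_interval reals topology normedtype.
(* The notations of mpoly clash with those of normedtype. *)
From mathcomp Require Import -(notations) mpoly.

Set Implicit Arguments.
Unset Strict Implicit.
Unset Printing Implicit Defensive.

Import Order.TTheory GRing.Theory Num.Theory.
Import numFieldNormedType.Exports.

Local Open Scope classical_set_scope.
Local Open Scope ring_scope.

Local Notation "{ 'mpoly' K [ n ] }" := (mpoly n K) : type_scope.

Section AlgebraicSets.
Variables (K : fieldType) (n : nat).
Implicit Types (V W : set 'rV[K]_n) (I : set {mpoly K[n]}).

Definition peval (p : {mpoly K[n]}) (x : 'rV[K]_n) : K :=
  meval (fun i => x 0 i) p.

Definition algebraic_set V :=
  exists ps : seq {mpoly K[n]},
    V = [set x | forall p, p \in ps -> peval p x = 0].

Definition irreducible_set V :=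
  ~ exists V1 V2, [/\ algebraic_set V1 /\ algebraic_set V2,
                      V1 !=set0 /\ V2 !=set0,
                      V1 `<` V /\ V2 `<` V
                    & V = V1 `|` V2].

Definition vanishing_ideal V : set {mpoly K[n]} :=
  [set p | forall x, V x -> peval p x = 0].

(* The residue classes of the entries of [f] are algebraically independent *)
(* over K in K[x]/I. *)
Definition alg_indep_mod I d (f : d.-tuple {mpoly K[n]}) :=
  forall P : {mpoly K[d]}, I (comp_mpoly f P) -> P = 0.

(* K[x]/I has transcendence degree d over K. *)
Definition trdeg_quotient I (d : nat) :=
  (exists f : d.-tuple {mpoly K[n]}, alg_indep_mod I f) /\
  (forall e (f : e.-tuple {mpoly K[n]}), alg_indep_mod I f -> (e <= d)%N).

Definition irreducible_variety_of_dim V (d : nat) :=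
  [/\ algebraic_set V, irreducible_set V
    & trdeg_quotient (vanishing_ideal V) d].

Definition algebraic_dim V (d : nat) :=
  (exists2 W, W `<=` V & irreducible_variety_of_dim W d) /\
  (forall W e, W `<=` V -> irreducible_variety_of_dim W e -> (e <= d)%N).

Definition algebraic_curve V := algebraic_set V /\ algebraic_dim V 1.

(* The hyperplane a.x = c is the zero set of this polynomial when a != 0. *)
Definition hyperplane_poly (a : 'rV[K]_n) (c : K) : {mpoly K[n]} :=
  \sum_(i < n) a 0 i *: mpolyX K (mnm1 i) - mpolyC n c.

Definition hyperplane (a : 'rV[K]_n) (c : K) : set 'rV[K]_n :=
  [set x | peval (hyperplane_poly a c) x = 0].

(* The ideal I(V) + (h). *)
Definition section_ideal V (h : {mpoly K[n]}) : set {mpoly K[n]} :=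
  [set p | exists g q, vanishing_ideal V g /\ p = g + q * h].

(* The images of the f_i in the local ring (K[x]/I)_x are linearly          *)
(* independent over K: a polynomial is zero there iff some s with s(x) != 0 *)
(* multiplies it into I. *)
Definition local_indep I (x : 'rV[K]_n) k (f : 'I_k -> {mpoly K[n]}) :=
  forall (a : 'I_k -> K) (s : {mpoly K[n]}),
    peval s x != 0 -> I (s * \sum_i a i *: f i) -> forall i, a i = 0.

(* m = dim_K (K[x]/I)_x.  It is enough to consider families of polynomials, *)
(* since finitely many fractions have a common denominator, a unit. *)
Definition local_mult I (x : 'rV[K]_n) (m : nat) :=
  (exists f : 'I_m -> {mpoly K[n]}, local_indep I x f) /\
  (forall k (f : 'I_k -> {mpoly K[n]}), local_indep I x f -> (k <= m)%N).

(* V and the hyperplane a.x = c meet in finitely many points, the sum of   *)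
(* whose intersection multiplicities dim_K (K[x]/(I(V) + (a.x - c)))_x is d. *)
Definition meets_hyperplane_in V (a : 'rV[K]_n) (c : K) (d : nat) :=
  exists (pts : seq 'rV[K]_n) (m : 'rV[K]_n -> nat),
    [/\ uniq pts, [set` pts] = V `&` hyperplane a c,
        forall x, x \in pts ->
          local_mult (section_ideal V (hyperplane_poly a c)) x (m x)
      & (\sum_(x <- pts) m x)%N = d].

End AlgebraicSets.

(* "Generic" refers to a non-empty Zariski open set of parameters (a, c). *)
Definition complex_degree (K : closedFieldType) n (C : set 'rV[K]_n) (d : nat) :=
  exists2 Q : {mpoly K[n + 1]}, Q != 0 &
    forall (a : 'rV[K]_n) (c : K),
      a != 0 -> peval Q (row_mx a c%:M) != 0 -> meets_hyperplane_in C a c d.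

Section RealCurves.
Variables (R : realType) (n : nat).

Definition complexify (x : 'rV[R]_n) : 'rV[R[i]]_n := map_mx (real_complex R) x.

Definition smallest_complex_curve (V : set 'rV[R]_n) (C : set 'rV[R[i]]_n) :=
  [/\ algebraic_curve C, complexify @` V `<=` C
    & forall D, algebraic_curve D -> complexify @` V `<=` D -> C `<=` D].

Definition real_degree (V : set 'rV[R]_n) (d : nat) :=
  exists2 C, smallest_complex_curve V C & complex_degree C d.

End RealCurves.

Section Multijoints.
Variable R : realType.
Local Notation R3 := 'rV[R]_3.
Implicit Types (x : R3) (gamma A N : set R3).

(* f restricts to a homeomorphism from [0, 1) onto A, with f 0 = x. *)
Definition parametrises (f : R -> R3) x A :=
  [/\ f 0 = x, f @` `[0, 1[ = A, {within `[0, 1[, continuous f}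
    & exists2 g : R3 -> R, {within A, continuous g} & {in `[0, 1[, cancel f g}].

(* A neighbourhood N of x in gamma that is the union of k parametrised curves *)
(* starting at x. *)
Definition star_neighbourhood gamma x k (A : 'I_k -> set R3) N :=
  [/\ N `<=` gamma, within gamma (nbhs x) N,
      forall i, exists f, parametrises f x (A i)
    & N = \bigcup_i A i].

(* The right derivative of f at 0 is v. *)
Definition right_derivative0 (f : R -> R3) (v : R3) :=
  h^-1 *: (f h - f 0) @[h --> 0^'+] --> v.

(* v is a direction of a line tangent to gamma at x. *)
Definition tangent_direction gamma x (v : R3) :=
  v != 0 /\
  exists k (A : 'I_k -> set R3) N (i : 'I_k) f u,
    [/\ star_neighbourhood gamma x A N, parametrises f x (A i),
        right_derivative0 f u, u != 0 & exists c : R, v = c *: u].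

Definition tangent_directions (Gamma : set (set R3)) x : set R3 :=
  [set v | exists gamma, [/\ Gamma gamma, gamma x & tangent_direction gamma x v]].

Definition multijoint (Gamma1 Gamma2 Gamma3 : set (set R3)) x :=
  [/\ exists2 gamma, Gamma1 gamma & gamma x,
      exists2 gamma, Gamma2 gamma & gamma x,
      exists2 gamma, Gamma3 gamma & gamma x
    & exists v1 v2 v3 : R3,
        [/\ tangent_directions Gamma1 x v1, tangent_directions Gamma2 x v2,
            tangent_directions Gamma3 x v3 & <<[:: v1; v2; v3]>>%VS = fullv]].

End Multijoints.

(* Main.v *)
Require Import Defs.
From HB Require Import structures.
From mathcomp Require Import all_boot all_order all_algebra.
From mathcomp Require Import finmap complex.
From mathcomp Require Import boolp classical_sets functions cardinality.
From mathcomp Require Import set_interval reals topology normedtype.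
From mathcomp Require Import -(notations) mpoly.
From mathcomp Require Import separable.
From mathcomp Require Import ring zify.

Set Implicit Arguments.
Unset Strict Implicit.
Unset Printing Implicit Defensive.

Import Order.TTheory GRing.Theory Num.Theory.
Import numFieldNormedType.Exports.

Local Open Scope classical_set_scope.
Local Open Scope ring_scope.

Local Notation "{ 'mpoly' K [ n ] }" := (mpoly n K) : type_scope.
Local Notation mX i := (mpolyX _ (mnm1 i)).
Local Notation msz := (mmeasure mdeg).

(* A tangent arc f of a curve at a joint is replaced by the prime ideal P_f of *)
(* the polynomials vanishing along f almost everywhere for a fixed ultrafilter *)
(* refining 0^'+; it stands for the component of the curve containing f.       *)
(*   Suppose that in a set J of joints every component of the i-th family that *)
(* occurs carries at least N_i joints.  If |J| were small against N_1 N_2 N_3, *)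
(* some nonzero polynomial of degree at most n would have, at each joint and   *)
(* in the basis of tangents, all Taylor coefficients zero on a box of sides    *)
(* C n / N_i.  At a joint where it vanishes to the least order a, a mixed      *)
(* derivative along two of the tangents would violate Bezout's bound on the    *)
(* component of the third one.  Hence N_1 N_2 N_3 <= C |J|, and removing the   *)
(* components with fewer than |J| / (4 K_i) joints, where K_i is the number of *)
(* components of the i-th family, gives |J|^2 <= C K_1 K_2 K_3.                *)
(*   Both Bezout's bound and the number of components of a curve of degree d   *)
(* come from the Hilbert function of P_f, which grows with slope at most d^2:  *)
(* a generic hyperplane section has at most d points, so two of the            *)
(* coordinates have degree at most d over the field of fractions of the third. *)

(** * Polynomials, directional derivatives and order of vanishing *)

(** The argument is the polynomial method, applied to components of the curves. For an ultrafilter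
    refining the right neighbourhoods of 0, the polynomials vanishing along a tangent arc form a
    prime ideal ([real_germ], [complex_germ]). The degree hypothesis enters through [section_bound]:
    a generic hyperplane meets the complex curve in at most d points. Two facts follow: the Hilbert
    function of a germ ideal has slope at most d^2 ([uniform_growth]), and at most d germ ideals
    occur on one curve ([prime_count]).

    Slope S yields [bezout]: if a polynomial of degree at most n lies outside the ideal and vanishes
    to order a at the base points of N arcs with that ideal, then a N <= S n. Orders are read off
    from leading terms along arcs ([cvg_lead]), for which a one-sided derivative is enough.

    For a set J of joints in which every component of the i-th family that occurs carries at least
    N_i points, counting coefficients against Taylor conditions in the tangent bases, together with
    [box_vanishing], gives N_1 N_2 N_3 <= 27 S^3 |J| ([key_count]). [rich_subset] prunes any n
    joints to such a J with N_i > n / (4 K_i), where K_i counts components. In [joint_count] these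
    bounds are multiplied, one factor n cancels, and n^2 is bounded by a constant times K_1 K_2
    K_3. *)

Section MPolyBasics.
Variables (n : nat) (K : fieldType).
Implicit Types (p q : {mpoly K[n]}) (v w x : 'rV[K]_n).

Lemma mpoly_ring_ind (Pr : {mpoly K[n]} -> Prop) :
  (forall c, Pr (mpolyC n c)) -> (forall i, Pr (mX i)) ->
  (forall p q, Pr p -> Pr q -> Pr (p + q)) ->
  (forall p q, Pr p -> Pr q -> Pr (p * q)) -> forall p, Pr p.
Proof.
move=> PC PX PD PM; apply: mpolyind => [|c m p mp c0 Pp]; first by rewrite -mpolyC0.
apply: (PD); last exact: Pp.
rewrite -mul_mpolyC; apply: (PM); first exact: PC.
rewrite mpolyXE_id; apply: (big_ind Pr); [by rewrite -mpolyC1 | exact: PM | move=> i _].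
elim: (m i) => [|k IH]; first by rewrite expr0 -mpolyC1.
by rewrite exprS; apply: (PM).
Qed.

Lemma pevalD x p q : peval (p + q) x = peval p x + peval q x.
Proof. exact: mevalD. Qed.

Lemma pevalM x p q : peval (p * q) x = peval p x * peval q x.
Proof. exact: mevalM. Qed.

Lemma pevalB x p q : peval (p - q) x = peval p x - peval q x.
Proof. exact: mevalB. Qed.

Lemma pevalZ x c p : peval (c *: p) x = c * peval p x.
Proof. exact: mevalZ. Qed.

Lemma pevalC x c : peval (mpolyC n c) x = c.
Proof. exact: mevalC. Qed.

Lemma pevalX x i : peval (mX i) x = x 0 i.
Proof. exact: mevalXU. Qed.

Lemma peval0 x : peval (0 : {mpoly K[n]}) x = 0.
Proof. exact: meval0. Qed.

Lemma peval1 x : peval (1 : {mpoly K[n]}) x = 1.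
Proof. exact: meval1. Qed.

Lemma peval_sum x (I : Type) (r : seq I) (Pr : pred I) (F : I -> {mpoly K[n]}) :
  peval (\sum_(i <- r | Pr i) F i) x = \sum_(i <- r | Pr i) peval (F i) x.
Proof. exact: raddf_sum. Qed.

Lemma pevalXn x p k : peval (p ^+ k) x = peval p x ^+ k.
Proof. exact: rmorphXn. Qed.

Lemma peval_prod x (I : Type) (r : seq I) (Pr : pred I) (F : I -> {mpoly K[n]}) :
  peval (\prod_(i <- r | Pr i) F i) x = \prod_(i <- r | Pr i) peval (F i) x.
Proof. exact: rmorph_prod. Qed.

Definition restr v w p : {poly K} :=
  mmap (@polyC K) (fun i => (v 0 i)%:P + w 0 i *: 'X) p.

Lemma restrE v w p s : (restr v w p).[s] = peval p (v + s *: w).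
Proof.
elim/mpoly_ring_ind: p => [c|i|p q|p q]; rewrite /restr.
- by rewrite mmapC hornerC pevalC.
- by rewrite mmapX mmap1U pevalX !hornerE !mxE mulrC.
- by rewrite mmapD hornerD pevalD => -> ->.
- by rewrite rmorphM hornerM pevalM /= => -> ->.
Qed.

Definition dird w p := \sum_i w 0 i *: mderiv i p.

Lemma dirdD w : {morph dird w : p q / p + q}.
Proof.
move=> p q; rewrite /dird -big_split; apply: eq_bigr => i _.
by rewrite mderivD scalerDr.
Qed.

Lemma dirdZ w c p : dird w (c *: p) = c *: dird w p.
Proof.
rewrite /dird scaler_sumr; apply: eq_bigr => i _.
by rewrite mderivZ !scalerA mulrC.
Qed.

Lemma dird_sum w (I : Type) (r : seq I) (Pr : pred I) (F : I -> {mpoly K[n]}) :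
  dird w (\sum_(i <- r | Pr i) F i) = \sum_(i <- r | Pr i) dird w (F i).
Proof.
have d0 : dird w 0 = 0 by have := dirdZ w 0 0; rewrite !scale0r.
exact: (big_morph _ (dirdD w) d0).
Qed.

Lemma dirdM w p q : dird w (p * q) = dird w p * q + p * dird w q.
Proof.
rewrite /dird mulr_suml mulr_sumr -big_split; apply: eq_bigr => i _.
by rewrite mderivM scalerDr -scalerAl -scalerAr.
Qed.

Lemma dird_mderiv w i p : dird w (mderiv i p) = mderiv i (dird w p).
Proof.
rewrite /dird raddf_sum; apply: eq_bigr => j _.
by rewrite /= mderivZ mderiv_comm.
Qed.

Lemma dirdC v w p : dird v (dird w p) = dird w (dird v p).
Proof.
rewrite {2}/dird dird_sum {2}/dird; apply: eq_bigr => i _.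
by rewrite dirdZ dird_mderiv.
Qed.

Lemma iter_dird_comm v w a p :
  iter a (dird v) (dird w p) = dird w (iter a (dird v) p).
Proof. by elim: a => // a IH; rewrite !iterS IH dirdC. Qed.

Lemma iter_dirdD a w : {morph iter a (dird w) : p q / p + q}.
Proof. by elim: a => [|a IH] p q //; rewrite !iterS IH dirdD. Qed.

Lemma iter_dirdZ a w c p : iter a (dird w) (c *: p) = c *: iter a (dird w) p.
Proof. by elim: a => // a IH; rewrite !iterS IH dirdZ. Qed.

Lemma deriv_restr v w p : (restr v w p)^`() = restr v w (dird w p).
Proof.
elim/mpoly_ring_ind: p => [c|i|p q|p q]; rewrite /restr.
- rewrite mmapC derivC /dird big1 ?mmap0 // => i _.
  by rewrite mderivC scaler0.
- rewrite mmapX mmap1U derivD derivC derivZ derivX add0r.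
  rewrite /dird raddf_sum (bigD1 i) //= big1 ?addr0 => [|j ne_ji].
    have -> : mderiv i (mX i) = 1 :> {mpoly K[n]}.
      rewrite mderivX mnm1E eqxx scale1r (_ : mnm_sub _ _ = mnm0) ?mpolyX0 //.
      by apply/mnmP => k; rewrite mnmBE subnn mnm0E.
    by rewrite mmapZ rmorph1 mulr1 alg_polyC.
  by rewrite mderivX mnm1E eq_sym (negbTE ne_ji) scale0r scaler0 mmap0.
- by rewrite mmapD derivD dirdD mmapD => -> ->.
- by rewrite rmorphM derivM dirdM mmapD !rmorphM /= => -> ->.
Qed.

Lemma msz_mderiv i p : (msz (mderiv i p) <= (msz p).-1)%N.
Proof.
rewrite /mderiv; apply: leq_trans (msize_sum _ _ _) _.
elim/big_ind: _ => // [a b ha hb|m _]; first by rewrite geq_max ha hb.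
have [->|mi0] := eqVneq (m i) 0%N; first by rewrite mul0r scale0r msize0.
have [mp|/memN_msupp_eq0 ->] := boolP (m \in msupp p); last first.
  by rewrite mulr0 scale0r msize0.
apply: leq_trans (msizeZ_le _ _) _; rewrite msizeX.
have := msize_mdeg_lt mp; suff -> : mdeg m = (mdeg (mnm_sub m (mnm1 i))).+1.
  by case: (msz p).
rewrite -addn1 -(mdeg1 i) -mdegD submK //; apply/mnm_lepP => l; rewrite mnm1E.
by case: eqP => // <-; rewrite lt0n.
Qed.

Lemma msz_dird w p : (msz (dird w p) <= (msz p).-1)%N.
Proof.
rewrite /dird; apply: leq_trans (msize_sum _ _ _) _.
elim/big_ind: _ => // [a b ha hb|i _]; first by rewrite geq_max ha hb.
exact: leq_trans (msizeZ_le _ _) (msz_mderiv _ _).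
Qed.

Lemma msz_iter_dird w a p : (msz (iter a (dird w) p) <= msz p - a)%N.
Proof.
elim: a => [|a IH] /=; first by rewrite subn0.
apply: leq_trans (msz_dird _ _) _; rewrite subnS.
by rewrite -!subn1 leq_sub2r.
Qed.

(** Order of vanishing at least [k]; recursion on first derivatives takes the place of
    multi-indices. *)
Fixpoint vanishes_to k p x : Prop :=
  if k is k'.+1 then peval p x = 0 /\ forall i, vanishes_to k' (mderiv i p) x
  else True.

Lemma vanishes_to_lin k x a p q :
  vanishes_to k p x -> vanishes_to k q x -> vanishes_to k (a *: p + q) x.
Proof.
elim: k p q => //= k IH p q [p0 pk] [q0 qk]; split=> [|i].
  by rewrite pevalD pevalZ p0 q0 mulr0 addr0.
by rewrite mderivD mderivZ; apply: IH.
Qed.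

Lemma vanishes_to0 k x : vanishes_to k 0 x.
Proof. by elim: k => //= k IH; split=> [|i]; rewrite ?peval0 ?mderiv0. Qed.

Lemma vanishes_to_sum k x (I : Type) (r : seq I) (c : I -> K)
    (F : I -> {mpoly K[n]}) :
  (forall l, vanishes_to k (F l) x) ->
  vanishes_to k (\sum_(i <- r) c i *: F i) x.
Proof.
move=> h; elim: r => [|i r IH]; first by rewrite big_nil; apply: vanishes_to0.
by rewrite big_cons; apply: vanishes_to_lin.
Qed.

Lemma vanishes_to_leq k l p x : (l <= k)%N -> vanishes_to k p x -> vanishes_to l p x.
Proof.
elim: k l p => [|k IH] [|l] p //= lk [p0 pk]; split=> // i.
by apply: IH.
Qed.

Lemma vanishes_to_dird k w p x :
  vanishes_to k.+1 p x -> vanishes_to k (dird w p) x.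
Proof. by move=> [_ h]; apply: vanishes_to_sum. Qed.

Lemma vanishes_to_iter_dird k a w p x :
  vanishes_to (k + a) p x -> vanishes_to k (iter a (dird w) p) x.
Proof.
elim: a k => [|a IH] k /=; first by rewrite addn0.
by rewrite addnS -addSn => /IH/vanishes_to_dird; apply.
Qed.

Lemma vanishes_to_peval_iter k a w p x :
  vanishes_to k p x -> (a < k)%N -> peval (iter a (dird w) p) x = 0.
Proof.
move=> pk ak; have /(vanishes_to_leq ak) := pk.
by rewrite -add1n => /vanishes_to_iter_dird-/(_ w) [].
Qed.

Lemma vanishes_to_basis (I : finType) (u : I -> 'rV[K]_n) k p x :
  (forall i, exists c : I -> K, delta_mx 0 i = \sum_j c j *: u j) ->
  peval p x = 0 -> (forall j, vanishes_to k (dird (u j) p) x) ->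
  vanishes_to k.+1 p x.
Proof.
move=> span p0 h; split=> // i; have [c ec] := span i.
suff -> : mderiv i p = \sum_j c j *: dird (u j) p by apply: vanishes_to_sum.
have -> : mderiv i p = dird (delta_mx 0 i) p.
  rewrite /dird (bigD1 i) //= big1 ?addr0 => [|j ne]; rewrite mxE !eqxx /= ?scale1r //.
  by rewrite (negbTE ne) scale0r.
rewrite ec /dird; under [RHS]eq_bigr do rewrite scaler_sumr.
rewrite exchange_big; apply: eq_bigr => l _; rewrite summxE scaler_suml.
by apply: eq_bigr => j _; rewrite mxE scalerA.
Qed.

(** When the order of [p] is exactly k + 1, some derivative along a basis vector has order exactly
    k, by [vanishes_to_basis]; the induction continues with that derivative. *)
Lemma exact_order (u : 'I_3 -> 'rV[K]_n) k p x :
  (forall i, exists c : 'I_3 -> K, delta_mx 0 i = \sum_j c j *: u j) ->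
  vanishes_to k p x -> ~ vanishes_to k.+1 p x ->
  exists a : 'I_3 -> nat, (a 0%R + a 1%R + a 2%:R%R)%N = k /\
    peval (iter (a 0) (dird (u 0)) (iter (a 1) (dird (u 1))
      (iter (a 2%:R) (dird (u 2%:R)) p))) x != 0.
Proof.
move=> span; elim: k p => [|k IH] p pk npk.
  by exists (fun=> 0%N); split=> //=; apply/eqP => p0; apply: npk; split.
have p0 : peval p x = 0 by case: pk.
have [j nj] : exists j, ~ vanishes_to k.+1 (dird (u j) p) x.
  by apply/not_existsP => h; apply: npk; apply: (vanishes_to_basis span) => // j; apply: contrapT.
have [a [ak pa]] := IH _ (vanishes_to_dird _ pk) nj.
exists (fun i => (i == j) + a i)%N; split; last first.
  move: pa; rewrite !iter_dird_comm.
  have [->|/negbTE h0] := eqVneq j 0; first by rewrite /= !add0n.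
  have [->|/negbTE h1] := eqVneq j 1; first by rewrite /= !add0n iter_dird_comm.
  have [->|/negbTE h2] := eqVneq j 2%:R.
    by rewrite /= !add0n !iter_dird_comm.
  by case: j h0 h1 h2 {nj} => -[|[|[|]]].
have : ((0 == j) + (1 == j) + (2%:R == j) = 1)%N.
  by case: j {pa nj} => -[|[|[|]]].
rewrite -ak; move: (a 0) (a 1) (a 2%:R) => a0 a1 a2.
by move: (nat_of_bool (0 == j)) (nat_of_bool (1 == j)) (nat_of_bool (2%:R == j)); lia.
Qed.

End MPolyBasics.

(** * Taylor expansion in characteristic zero *)

Section MPolyChar0.
Variables (n : nat) (K : numFieldType).
Implicit Types (p q : {mpoly K[n]}) (v w x : 'rV[K]_n).

Lemma mderiv_eq0_const p : (forall i, mderiv i p = 0) -> p = mpolyC n (mcoeff mnm0 p).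
Proof.
move=> h; apply/mpolyP => m; rewrite mcoeffC.
have [<-|m0] := eqVneq mnm0 m; first by rewrite mulr1.
rewrite mulr0.
have [i mi] : exists i, m i != 0%N.
  apply/not_existsP => hm; case/eqP: m0; apply/mnmP => i; rewrite mnm0E.
  by have /negP := hm i; rewrite negbK => /eqP.
have := mcoeff_mderiv i p (mnm_sub m (mnm1 i)); rewrite h mcoeff0 submK; last first.
  by apply/mnm_lepP => l; rewrite mnm1E; case: eqP => // <-; rewrite lt0n.
by move/esym/eqP; rewrite mulrn_eq0 /= => /eqP.
Qed.

(** By induction on the degree all first derivatives are zero, and in characteristic 0 only
    constants have this property. *)
Lemma vanishes_to_all p x : (forall k, vanishes_to k p x) -> p = 0.
Proof.
have [k] := ubnP (msz p); elim: k p => // k IH p pk h.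
have d0 i : mderiv i p = 0.
  have [->|p0] := eqVneq p 0; first by rewrite mderiv0.
  apply: IH => [|l]; last by have [_ /(_ i)] := h l.+1.
  apply: leq_ltn_trans (msz_mderiv _ _) _.
  by move: p0 pk; rewrite -msize_poly_eq0; case: (msz p).
have [] := h 1%N; rewrite (mderiv_eq0_const d0) pevalC => -> _.
by rewrite mpolyC0.
Qed.

Lemma poly_many_roots (p : {poly K}) : (forall k : nat, p.[k%:R] = 0) -> p = 0.
Proof.
move=> h; apply/eqP/negPn/negP => p0.
have := max_poly_roots p0 (rs := [seq k%:R | k <- iota 0 (size p)]).
rewrite size_map size_iota ltnn => H; suff: false by []; apply: H.
  by apply/allP => _ /mapP[k _ ->]; apply/rootP.
by rewrite map_inj_uniq ?iota_uniq // => a b /eqP; rewrite eqr_nat => /eqP.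
Qed.

(** On a line in a coordinate direction the restriction has all natural numbers as roots, hence is
    zero; so the partial derivatives vanish everywhere as well. *)
Lemma mpoly_vanish p : (forall x, peval p x = 0) -> p = 0.
Proof.
move=> h; apply: (@vanishes_to_all p 0) => k; elim: k p h => //= k IH p h; split=> // i.
apply: IH => x; pose w : 'rV[K]_n := delta_mx 0 i.
have r0 : restr x w p = 0 by apply: poly_many_roots => s; rewrite restrE.
have := congr1 (fun P : {poly K} => P^`().[0]) r0.
rewrite deriv_restr restrE deriv0 horner0 scale0r addr0 /dird (bigD1 i) //=.
rewrite big1 => [|j ne]; rewrite !mxE !eqxx ?scale1r ?addr0 //= (negbTE ne).
by rewrite scale0r.
Qed.

(** The [msz p]-th derivative along [w] kills [p], and in characteristic 0 this differentiation
    loses no coefficient of index at least [msz p]. *)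
Lemma size_restr v w p : (size (restr v w p) <= msz p)%N.
Proof.
have der k : (restr v w p)^`(k) = restr v w (iter k (dird w) p).
  by elim: k => [|k IH] //; rewrite derivnS IH iterS deriv_restr.
apply/leq_sizeP => j hj.
have z : iter (msz p) (dird w) p = 0.
  by apply/eqP; rewrite -msize_poly_eq0 -leqn0 (leq_trans (msz_iter_dird _ _ _)) // subnn.
have := congr1 (fun P : {poly K} => P`_(j - msz p)) (der (msz p)).
rewrite z coef_derivn subnKC // /restr mmap0 coef0 => /eqP.
by rewrite mulrn_eq0 eqn0Ngt ffact_gt0 hj => /eqP.
Qed.

Lemma mpoly_taylor N v w p s : (msz p <= N)%N ->
  peval p (v + s *: w) =
  \sum_(k < N) s ^+ k / k`!%:R * peval (iter k (dird w) p) v.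
Proof.
move=> pN; have der k : (restr v w p)^`(k) = restr v w (iter k (dird w) p).
  by elim: k => [|k IH] //; rewrite derivnS IH iterS deriv_restr.
rewrite -restrE (horner_coef_wide _ (leq_trans (size_restr v w p) pN)).
apply: eq_bigr => k _; have := congr1 (fun P : {poly K} => P.[0]) (der k).
rewrite restrE scale0r addr0 horner_coef0 coef_derivn addn0 ffactnn => <-.
have k0 : k`!%:R != 0 :> K by rewrite pnatr_eq0 -lt0n fact_gt0.
by rewrite -[_ *+ _]mulr_natr; field.
Qed.

End MPolyChar0.

(** * Prime ideals and their Hilbert functions *)

Definition prime_ideal (A : comNzRingType) (P : set A) :=
  [/\ P 0, forall x y, P x -> P y -> P (x + y), forall x y, P y -> P (x * y),
      forall x y, P (x * y) -> P x \/ P y & ~ P 1].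

Section PrimeIdeal.
Variables (A : comNzRingType) (P : set A).
Hypothesis Pprime : prime_ideal P.

Lemma prime_ideal0 : P 0. Proof. by case: Pprime. Qed.

Lemma prime_idealD x y : P x -> P y -> P (x + y).
Proof. by case: Pprime => _ + _ _ _; apply. Qed.

Lemma prime_idealMl x y : P y -> P (x * y).
Proof. by case: Pprime => _ _ + _ _; apply. Qed.

Lemma prime_idealMr x y : P x -> P (x * y).
Proof. by rewrite mulrC; apply: prime_idealMl. Qed.

Lemma prime_idealP x y : P (x * y) -> P x \/ P y.
Proof. by case: Pprime => _ _ _ + _; apply. Qed.

Lemma prime_ideal1 : ~ P 1. Proof. by case: Pprime. Qed.

Lemma prime_idealN x : P x -> P (- x).
Proof. by rewrite -mulN1r; apply: prime_idealMl. Qed.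

Lemma prime_idealB x y : P x -> P y -> P (x - y).
Proof. by move=> Px /prime_idealN; apply: prime_idealD. Qed.

Lemma prime_ideal_sum (I : Type) (r : seq I) (F : I -> A) :
  (forall i, P (F i)) -> P (\sum_(i <- r) F i).
Proof.
move=> h; elim: r => [|i r IH]; first by rewrite big_nil; apply: prime_ideal0.
by rewrite big_cons; apply: prime_idealD.
Qed.

Lemma prime_ideal_prod (I : finType) (Q : pred I) (F : I -> A) :
  P (\prod_(i | Q i) F i) -> exists2 i, Q i & P (F i).
Proof.
rewrite big_mkcond => h; apply: contrapT => no; move: h.
elim: (index_enum I) => [|i r IH]; first by rewrite big_nil => /prime_ideal1.
rewrite big_cons => /prime_idealP[|/IH//]; case: ifP => [Qi Pi|_ /prime_ideal1 //].
by apply: no; exists i.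
Qed.

Lemma prime_ideal_preim (B : comNzRingType) (f : {rmorphism B -> A}) :
  prime_ideal (f @^-1` P).
Proof.
split=> /= [|x y|x y|x y|].
- by rewrite rmorph0; apply: prime_ideal0.
- by rewrite rmorphD; apply: prime_idealD.
- by rewrite rmorphM; apply: prime_idealMl.
- by rewrite rmorphM; apply: prime_idealP.
- by rewrite rmorph1; apply: prime_ideal1.
Qed.

End PrimeIdeal.

(** * Linear algebra modulo a prime ideal *)

Section Span.
Variables (K : fieldType) (A : comAlgType K) (P : set A).
Hypothesis Pprime : prime_ideal P.
Implicit Types (B : set A).

(* spn B w: w is a linear combination of elements of B modulo P. *)
Inductive spn B : A -> Prop :=
| spn_ideal w : P w -> spn B w
| spn_cons c b w : B b -> spn B w -> spn B (c *: b + w).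

Lemma prime_idealZ c x : P x -> P (c *: x).
Proof. by move=> Px; rewrite -mulr_algl; apply: prime_idealMl. Qed.

Lemma spnD B w1 w2 : spn B w1 -> spn B w2 -> spn B (w1 + w2).
Proof.
move=> s1 s2; elim: s1 => [w Pw|c b w Bb _ IH]; last first.
  by rewrite -addrA; apply: spn_cons.
elim: s2 => [w' Pw'|c b w' Bb _ IH]; first by apply: spn_ideal; apply: prime_idealD.
by rewrite addrCA; apply: spn_cons.
Qed.

Lemma spnZ B c w : spn B w -> spn B (c *: w).
Proof.
elim=> [{}w Pw|d b {}w Bb _ IH]; first by apply: spn_ideal; apply: prime_idealZ.
by rewrite scalerDr scalerA; apply: spn_cons.
Qed.

Lemma spnB B w1 w2 : spn B w1 -> spn B w2 -> spn B (w1 - w2).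
Proof. by move=> s1 s2; rewrite -scaleN1r; apply/spnD/spnZ. Qed.

Lemma spn0 B : spn B 0. Proof. by apply: spn_ideal; apply: prime_ideal0 Pprime. Qed.

Lemma spn_base B b : B b -> spn B b.
Proof. by move=> Bb; rewrite -[b]scale1r -[_ *: _]addr0; apply/spn_cons/spn0. Qed.

Lemma spn_sum B (I : Type) (r : seq I) (Q : pred I) (F : I -> A) :
  (forall i, Q i -> spn B (F i)) -> spn B (\sum_(i <- r | Q i) F i).
Proof.
by move=> h; elim/big_ind: _ => //; [apply: spn0|move=> x y; apply: spnD].
Qed.

Lemma spn_mul x B B' w :
  (forall b, B b -> spn B' (x * b)) -> spn B w -> spn B' (x * w).
Proof.
move=> h; elim=> [{}w Pw|c b {}w Bb _ IH]; first by apply: spn_ideal; apply: prime_idealMl.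
by rewrite mulrDr -scalerAr; apply/spnD/IH/spnZ/h.
Qed.

Lemma spn_sub B B' w : (forall b, B b -> spn B' b) -> spn B w -> spn B' w.
Proof.
by move=> h; rewrite -[w in spn B' w]mul1r; apply: spn_mul => b; rewrite mul1r; apply: h.
Qed.

Lemma spn_empty B w : (forall b, ~ B b) -> spn B w -> P w.
Proof. by move=> hB; elim=> // c b v /hB. Qed.

Lemma spn_coord N (b : 'I_N -> A) w :
  spn (range b) w -> exists v : 'I_N -> K, P (w - \sum_i v i *: b i).
Proof.
elim=> [{}w Pw|c _ {}w [j _ <-] _ [v Pv]].
  by exists (fun=> 0); rewrite big1 ?subr0 // => i _; rewrite scale0r.
exists (fun i => (i == j)%:R * c + v i).
under eq_bigr do rewrite scalerDl; rewrite big_split /= (bigD1 j) //= eqxx mul1r.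
rewrite [X in _ - (_ + X + _)]big1 ?addr0; last by move=> i /negbTE ->; rewrite mul0r scale0r.
by rewrite opprD addrACA subrr add0r.
Qed.

Lemma spn_dependent N M (b : 'I_N -> A) (w : 'I_M -> A) :
  (N < M)%N -> (forall i, spn (range b) (w i)) ->
  exists v : 'I_M -> K, (exists i, v i != 0) /\ P (\sum_i v i *: w i).
Proof.
move=> NM h; have /choice[c hc] : forall i, exists v : 'I_N -> K,
  P (w i - \sum_j v j *: b j) by move=> i; apply: spn_coord.
pose C : 'M[K]_(M, N) := \matrix_(i, j) c i j.
have kn0 : kermx C != 0.
  rewrite -mxrank_eq0 mxrank_ker -lt0n subn_gt0.
  exact: leq_ltn_trans (rank_leq_col _) NM.
have /rowV0Pn[v vk v0] := kn0.
exists (fun i => v 0 i); split.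
  apply/not_existsP => hv; move/eqP: v0; apply; apply/rowP => i; rewrite mxE.
  by apply/eqP/negPn/negP/hv.
have : P (\sum_i v 0 i *: (w i - \sum_j c i j *: b j)).
  by apply: prime_ideal_sum => // i; apply: prime_idealZ.
congr P; under eq_bigr do rewrite scalerBr; rewrite sumrB.
rewrite [X in _ - X](_ : _ = 0) ?subr0 //.
under eq_bigr do rewrite scaler_sumr; rewrite exchange_big big1 // => j _.
have /sub_kermxP/matrixP/(_ 0 j) := vk; rewrite mxE mxE => e.
rewrite -[RHS](scale0r (b j)) -e scaler_suml; apply: eq_bigr => i _.
by rewrite scalerA mxE.
Qed.

End Span.

Section Degree.
Variables (n : nat) (K : fieldType).
Implicit Types p q : {mpoly K[n]}.

Definition deg_le m p := (msz p <= m.+1)%N.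

Lemma deg_leM a b p q : deg_le a p -> deg_le b q -> deg_le (a + b) (p * q).
Proof.
rewrite /deg_le => pa qb.
have [->|p0] := eqVneq p 0; first by rewrite mul0r msize0.
have [->|q0] := eqVneq q 0; first by rewrite mulr0 msize0.
by rewrite msizeM //; move: pa qb; move: (msz p) (msz q) => x y; lia.
Qed.

Lemma deg_leX a k p : deg_le a p -> deg_le (k * a) (p ^+ k).
Proof.
move=> pa; elim: k => [|k IH]; first by rewrite expr0 /deg_le msize1.
by rewrite exprS mulSn; apply: deg_leM.
Qed.

Lemma deg_leW a b p : (a <= b)%N -> deg_le a p -> deg_le b p.
Proof. by rewrite /deg_le => ab /leq_trans; apply; rewrite ltnS. Qed.

Lemma deg_leD a p q : deg_le a p -> deg_le a q -> deg_le a (p + q).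
Proof. by rewrite /deg_le => pa qa; rewrite (leq_trans (msizeD_le _ _)) // geq_max pa. Qed.

Lemma deg_leZ a c p : deg_le a p -> deg_le a (c *: p).
Proof. by rewrite /deg_le => /(leq_trans (msizeZ_le _ _)). Qed.

Lemma deg_le_mX i : deg_le 1 (mX i : {mpoly K[n]}).
Proof. by rewrite /deg_le msizeX mdeg1. Qed.

(* The Hilbert function m |-> dim of K[x]_{<= m}/P is at most S * m + O(1). *)
Definition growth (P : set {mpoly K[n]}) S :=
  exists C, forall m M (w : 'I_M -> {mpoly K[n]}), (S * (m + C) < M)%N ->
    (forall i, deg_le m (w i)) ->
    exists v : 'I_M -> K, (exists i, v i != 0) /\ P (\sum_i v i *: w i).

End Degree.

Definition evalp (S A : comNzRingType) (f : {rmorphism S -> A}) (z : A) :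
    {poly S} -> A :=
  horner_eval z \o map_poly f.

Section Evalp.
Variables (S A : comNzRingType) (f : {rmorphism S -> A}) (z : A).

HB.instance Definition _ := GRing.RMorphism.on (evalp f z).

Lemma evalpX : evalp f z 'X = z.
Proof. by rewrite /evalp /= map_polyX horner_evalE hornerX. Qed.

Lemma evalpC s : evalp f z s%:P = f s.
Proof. by rewrite /evalp /= map_polyC horner_evalE hornerC. Qed.

End Evalp.

(** The inner variable stands for [t], the outer one for [y]: sizes and leading coefficients refer
    to [y] over K[t]. *)
Definition eval2 (K : fieldType) (A : comAlgType K) (t y : A) :
    {poly {poly K}} -> A :=
  evalp (horner_alg t) y.

Section Eval2.
Variables (K : fieldType) (A : comAlgType K) (t y : A).

HB.instance Definition _ := GRing.RMorphism.on (eval2 t y).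

Lemma eval2X : eval2 t y 'X = y.
Proof. exact: evalpX. Qed.

Lemma eval2C q : eval2 t y q%:P = horner_alg t q.
Proof. exact: evalpC. Qed.

Lemma eval2CX : eval2 t y 'X%:P = t.
Proof. by rewrite eval2C horner_algX. Qed.

Lemma horner_alg_sum N (q : {poly K}) : (size q <= N)%N ->
  horner_alg t q = \sum_(i < N) q`_i *: t ^+ i.
Proof.
move=> qN; rewrite /horner_alg /= /horner_morph.
rewrite (horner_coef_wide _ (leq_trans (size_poly _ _) qN)).
by apply: eq_bigr => i _; rewrite coef_map mulr_algl.
Qed.

Lemma eval2E r : eval2 t y r = \sum_(i < size r) horner_alg t r`_i * y ^+ i.
Proof.
rewrite /eval2 /evalp /= horner_evalE (horner_coef_wide _ (size_poly _ _)).
by apply: eq_bigr => i _; rewrite coef_map.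
Qed.

End Eval2.

Section Norm.
Variables (n : nat) (K : fieldType) (P : set {mpoly K[n]}) (E : nat).
Hypotheses (Pprime : prime_ideal P) (Pgrowth : growth P E).

(* Counting monomials t^i g^j yields a relation between t and g modulo P; as  *)
(* g is not in P, its constant term in g may be taken nonzero, and is then a  *)
(* nonzero polynomial in t lying in P + (g). *)
Lemma growth_relation t g : deg_le 1 t -> ~ P g ->
  exists2 r : {poly {poly K}}, r`_0 != 0 & P (eval2 t g r).
Proof.
move=> dt gP; have [C hC] := Pgrowth.
pose d := msz g; have dg : deg_le d g by rewrite /deg_le leqW.
(* There are k * l products g^j t^i with j < k and i < l, of degree at most k * d + l. As k = E + 1,
   the surplus l of k * l over E * l beats the constant E * (k * d + C). *)
pose k := E.+1; pose l := (E * (k * d + C)).+1.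
have kl : (E * (k * d + l + C) < k * l)%N by rewrite /k /l; nia.
pose w (i : 'I_(k * l)) := g ^+ (i %/ l) * t ^+ (i %% l).
have [|v [[i0 vi0] Pv]] := hC _ _ w kl.
  move=> i; rewrite /w; have lt_i : (i < k * l)%N by [].
  have l0 : (0 < l)%N by [].
  apply: deg_leW (deg_leM (deg_leX (i %/ l) dg) (deg_leX (i %% l) dt)).
  rewrite muln1 leq_add //; last exact/ltnW/ltn_pmod.
  by rewrite leq_mul2r (ltnW _) ?orbT // ltn_divLR.
have [r r0 Pr] : exists2 r : {poly {poly K}}, r != 0 & P (eval2 t g r).
  exists (\sum_i v i *: 'X^(i %% l) *: 'X^(i %/ l)).
    apply/eqP => /(congr1 (fun r : {poly {poly K}} => r`_(i0 %/ l)`_(i0 %% l))).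
    rewrite !coef0 coef_sum coef_sum (bigD1 i0) //= big1 => [|i ne_i].
      by rewrite addr0 !coefZ !coefXn !eqxx !mulr1 coefZ coefXn eqxx mulr1 => /eqP; apply/negP.
    rewrite coefZ coefXn; case: eqP => [e1|]; last by rewrite mulr0 coef0.
    rewrite mulr1 coefZ coefXn; case: eqP => [e2|]; last by rewrite mulr0.
    by case/eqP: ne_i; apply/val_inj; rewrite /= (divn_eq i l) (divn_eq i0 l) e1 e2.
  move: Pv; congr P; rewrite rmorph_sum; apply: eq_bigr => i _.
  rewrite -[_ *: 'X^(i %/ l)]mul_polyC rmorphM /= eval2C rmorphXn /= eval2X.
  by rewrite linearZ rmorphXn /= horner_algX mulr_algl -scalerAl mulrC.
(* A factor of the outer variable evaluates to [g], and is cancelled because P is prime and does not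
   contain [g]. *)
have [s] := ubnP (size r); elim: s r r0 Pr => // s IH r r0 Pr szr.
have [rc0|] := eqVneq r`_0 0; last by exists r.
have er : r = drop_poly 1 r * 'X.
  by apply/polyP => -[|i]; rewrite coefMX //= coef_drop_poly addn1.
have [||//|r' r'0 Pr'] := IH (drop_poly 1 r); last by exists r'.
- by apply: contraNneq r0 => r'0; rewrite er r'0 mul0r.
- by move: Pr; rewrite {1}er rmorphM /= eval2X => /(prime_idealP Pprime)[].
- rewrite size_drop_poly; move: szr; have := r0; rewrite -size_poly_eq0.
  by case: (size r) => // x _; rewrite subSS subn0.
Qed.

End Norm.

(** * Specialisation of a prime ideal at a generic point *)

Section Extension.
Variables (S : idomainType) (P : set {poly S}).
Hypothesis Pprime : prime_ideal P.

(** An element of P shorter than [m] has its leading coefficient in P, so its leading term can be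
    removed without leaving P. *)
Lemma coef_below_minimal m :
  (forall M, P M -> ~ P (lead_coef M)%:P -> (m <= size M)%N) ->
  forall p, P p -> (size p < m)%N -> forall i, P (p`_i)%:P.
Proof.
move=> min p; have [s] := ubnP (size p); elim: s p => // s IH p szp Pp pm i.
have Plc : P (lead_coef p)%:P.
  by apply: contrapT => /(min _ Pp); rewrite leqNgt pm.
have [p0|p0] := eqVneq p 0; first by rewrite p0 coef0; apply: prime_ideal0 Pprime.
pose k := (size p).-1.
have sk : size p = k.+1 by rewrite prednK // lt0n size_poly_eq0.
have ep : take_poly k p = p - (lead_coef p)%:P * 'X^k.
  apply/polyP => j; rewrite coef_take_poly coefB coefCM coefXn lead_coefE -/k.
  have [jk|kj|->] := ltngtP j k; rewrite ?mulr0 ?mulr1 ?subr0 ?subrr //.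
  by rewrite nth_default // sk.
have [->|ne_ik] := eqVneq i k; first exact: Plc.
have [ik|ki] := ltnP i k; last first.
  rewrite nth_default; first exact: prime_ideal0 Pprime.
  by rewrite sk ltn_neqAle eq_sym ne_ik.
have -> : p`_i = (take_poly k p)`_i by rewrite coef_take_poly ik.
have szt : (size (take_poly k p) <= k)%N := size_take_poly _ _.
apply: IH.
- by apply: leq_ltn_trans szt _; rewrite -sk.
- by rewrite ep; apply: prime_idealB => //; apply: prime_idealMr.
- by apply: leq_ltn_trans szt _; apply: leq_trans pm; rewrite sk.
Qed.

Lemma minimal_lead p i : P p -> ~ P (p`_i)%:P ->
  exists M, [/\ P M, ~ P (lead_coef M)%:P &
    forall q, P q -> (size q < size M)%N -> forall i, P (q`_i)%:P].
Proof.
move=> Pp npi.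
pose Q m := `[< exists M, [/\ P M, ~ P (lead_coef M)%:P & size M = m] >].
have [m Qm] : exists m, Q m.
  apply: contrapT => no; apply: npi.
  apply: (@coef_below_minimal (size p).+1) => // M PM nM.
  by case: no; exists (size M); apply/asboolP; exists M.
have [k /asboolP[M [PM nM <-]] kmin] := @ex_minnP Q (ex_intro _ m Qm).
exists M; split=> //; apply: coef_below_minimal => N PN nN.
by apply: kmin; apply/asboolP; exists N.
Qed.

Lemma minimal_size M : P M -> ~ P (lead_coef M)%:P -> (1 < size M)%N.
Proof.
move=> PM nM; rewrite ltnNge; apply/negP => /size1_polyC eM; apply: nM.
by rewrite eM lead_coefC -eM.
Qed.

(* Division by M shows that a root of M kills all of P. *)
Lemma minimal_specialization (K : idomainType) (psi : {rmorphism S -> K}) (M : {poly S}) zeta :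
  (forall q, P q -> (size q < size M)%N -> forall i, P (q`_i)%:P) ->
  (forall s, P s%:P -> psi s = 0) -> P M -> psi (lead_coef M) != 0 ->
  root (map_poly psi M) zeta ->
  forall p, P p -> (map_poly psi p).[zeta] = 0.
Proof.
move=> min kill PM lM /rootP Mz p Pp.
have M0 : M != 0 by apply: contraNneq lM => ->; rewrite lead_coef0 rmorph0.
have eqp := Pdiv.Idomain.divp_eq p M.
have Pr : P (p %% M)%R.
  have -> : (p %% M)%R = lead_coef M ^+ scalp p M *: p - (p %/ M)%R * M.
    by rewrite eqp addrC addKr.
  by rewrite -mul_polyC; apply: prime_idealB => //; apply: prime_idealMl.
have r0 : map_poly psi (p %% M)%R = 0.
  apply/polyP => i; rewrite coef_map coef0; apply: kill.
  by apply: min => //; rewrite ltn_modp.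
have := congr1 (fun q => (map_poly psi q).[zeta]) eqp.
rewrite rmorphD /= r0 addr0 rmorphM /= hornerM Mz mulr0 -mul_polyC rmorphM /=.
rewrite map_polyC hornerM hornerC => /eqP.
rewrite mulf_eq0 => /orP[|/eqP //]; rewrite -[X in X == 0]/(psi _) rmorphXn.
by rewrite expf_eq0 (negbTE lM) andbF.
Qed.

(** The extension theorem of elimination. For [s] one takes the leading coefficient of a shortest
    [M] in P whose leading coefficient is outside P; where [s] survives, a root of the specialised
    [M] is a zero of all of P. *)
Lemma generic_extension (K : closedFieldType) : exists s, ~ P s%:P /\
  forall psi : {rmorphism S -> K}, (forall u, P u%:P -> psi u = 0) ->
    psi s != 0 -> exists zeta, forall p, P p -> (map_poly psi p).[zeta] = 0.
Proof.
have [all_in|] := pselect (forall p, P p -> forall i, P (p`_i)%:P).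
  exists 1; split=> [|psi kill _]; first exact: prime_ideal1 Pprime.
  (* Here P puts no constraint on the new variable, and any value would serve. *)
  exists 0 => p Pp; rewrite (_ : map_poly psi p = 0) ?horner0 //.
  by apply/polyP => i; rewrite coef_map coef0; apply/kill/all_in.
move=> /existsNP[p /not_implyP[Pp /existsNP[i npi]]].
have [M [PM nM min]] := minimal_lead Pp npi.
exists (lead_coef M); split=> // psi kill lM.
have [z rz] : exists z, root (map_poly psi M) z.
  by apply/closed_rootP; rewrite size_map_poly_id0 // gtn_eqF // minimal_size.
by exists z; apply: minimal_specialization lM rz.
Qed.

End Extension.

Definition linform (n : nat) (K : fieldType) (a : 'rV[K]_n) : {mpoly K[n]} :=
  \sum_i a 0 i *: mX i.

Lemma peval_linform (n : nat) (K : fieldType) (a x : 'rV[K]_n) :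
  peval (linform a) x = \sum_i a 0 i * x 0 i.
Proof. by rewrite peval_sum; apply: eq_bigr => i _; rewrite pevalZ pevalX. Qed.

Lemma hyperplane_polyE (n : nat) (K : fieldType) (a : 'rV[K]_n) c :
  hyperplane_poly a c = linform a - mpolyC n c.
Proof. by []. Qed.

Lemma deg_le_linform (n : nat) (K : fieldType) (a : 'rV[K]_n) : deg_le 1 (linform a).
Proof.
rewrite /linform; elim/big_rec: _ => [|i p _]; first by rewrite /deg_le msize0.
by apply: deg_leD; apply/deg_leZ/deg_le_mX.
Qed.

Definition pt2 (K : fieldType) (c eta : K) : {poly {poly K}} -> K :=
  evalp (horner_eval c) eta.

Section Pt2.
Variables (K : fieldType) (c eta : K).

HB.instance Definition _ := GRing.RMorphism.on (pt2 c eta).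

Lemma pt2X : pt2 c eta 'X = eta.
Proof. exact: evalpX. Qed.

Lemma pt2C q : pt2 c eta q%:P = q.[c].
Proof. exact: evalpC. Qed.

End Pt2.

Lemma mmap_retract (n : nat) (K : fieldType) (B : comNzRingType)
    (k : {rmorphism K -> B}) (X : 'I_n -> B) (phi : {rmorphism B -> {mpoly K[n]}}) g :
  (forall c, phi (k c) = mpolyC n c) -> (forall i, phi (X i) = mX i) ->
  phi (mmap k X g) = g.
Proof.
move=> phik phiX; elim/mpoly_ring_ind: g => [c|i|p q|p q].
- by rewrite mmapC phik.
- by rewrite mmapX mmap1U phiX.
- by rewrite mmapD rmorphD => -> ->.
- by rewrite !rmorphM => -> ->.
Qed.

Lemma mmap_peval (n : nat) (K : fieldType) (B : comNzRingType)
    (k : {rmorphism K -> B}) (X : 'I_n -> B) (psi : {rmorphism B -> K}) g :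
  (forall c, psi (k c) = c) ->
  psi (mmap k X g) = peval g (\row_i psi (X i)).
Proof.
move=> psik; elim/mpoly_ring_ind: g => [c|i|p q|p q].
- by rewrite mmapC psik pevalC.
- by rewrite mmapX mmap1U pevalX mxE.
- by rewrite mmapD rmorphD pevalD => -> ->.
- by rewrite !rmorphM pevalM /= => -> ->.
Qed.

Definition zeros (n : nat) (K : fieldType) (P : set {mpoly K[n]}) : set 'rV[K]_n :=
  [set x | forall g, P g -> peval g x = 0].

(** The coordinates 1 and 2 in either order, so that each lemma on the first of them serves for
    both; the coordinate 0 is traded for a linear form. *)
Definition other_coords (j1 j2 : 'I_3) :=
  (j1 == 1) && (j2 == 2%:R) || (j1 == 2%:R) && (j2 == 1).

Lemma sum_other_coords (V : zmodType) (F : 'I_3 -> V) j1 j2 : other_coords j1 j2 ->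
  \sum_i F i = F 0 + F j1 + F j2.
Proof.
move=> h; have e i : F i = F (inord i) by rewrite inord_val.
rewrite !big_ord_recl big_ord0 addr0 addrA.
case/orP: h => /andP[/eqP-> /eqP->]; last rewrite addrAC;
  by congr (_ + F _ + F _); apply/val_inj.
Qed.

Section Lift.
Variables (K : closedFieldType) (P : set {mpoly K[3]}) (a : 'rV[K]_3).
Variables (j1 j2 : 'I_3).
Hypotheses (Pprime : prime_ideal P) (a0 : a 0 0 != 0) (hj : other_coords j1 j2).

Local Notation t := (linform a).
Local Notation y := (mX j1 : {mpoly K[3]}).
Local Notation z := (mX j2 : {mpoly K[3]}).

(** As a_0 is nonzero, [t], [y], [z] are again coordinates of the space, and [generic_extension]
    applies to the projection forgetting [z]. *)
Lemma lift_zeros : exists s : {poly {poly K}}, ~ P (eval2 t y s) /\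
  forall c eta, (forall G, P (eval2 t y G) -> pt2 c eta G = 0) ->
    pt2 c eta s != 0 ->
    exists x, [/\ zeros P x, \sum_i a 0 i * x 0 i = c & x 0 j1 = eta].
Proof.
pose Phi : {rmorphism {poly {poly {poly K}}} -> {mpoly K[3]}} :=
  @evalp {poly {poly K}} {mpoly K[3]} (eval2 t y) z.
have PhiC s : Phi s%:P = eval2 t y s by exact: evalpC.
have PhiX : Phi 'X = z by exact: evalpX.
pose k3 := (@polyC {poly {poly K}} \o @polyC {poly K}) \o @polyC K.
(* The old coordinates in terms of the new ones; the coordinate 0 is solved for from t = a . x. *)
pose X i : {poly {poly {poly K}}} := if i == j1 then 'X%:P else if i == j2 then 'X else
  k3 (a 0 0)^-1 * ('X%:P%:P - k3 (a 0 j1) * 'X%:P - k3 (a 0 j2) * 'X).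
pose L : {mpoly K[3]} -> {poly {poly {poly K}}} := mmap k3 X.
have j10 : (0 == j1) = false by case/orP: hj => /andP[/eqP-> _].
have j20 : (0 == j2) = false by case/orP: hj => /andP[_ /eqP->].
have j21 : (j2 == j1) = false by case/orP: hj => /andP[/eqP-> /eqP->].
have jcase i : [\/ i = 0, i = j1 | i = j2].
  case/orP: hj => /andP[/eqP-> /eqP->]; case: i => -[|[|[|//]]] hi.
  - by constructor 1; apply/val_inj.
  - by constructor 2; apply/val_inj.
  - by constructor 3; apply/val_inj.
  - by constructor 1; apply/val_inj.
  - by constructor 3; apply/val_inj.
  - by constructor 2; apply/val_inj.
have Phik c : Phi (k3 c) = mpolyC 3 c.
  by rewrite /k3 /= PhiC eval2C horner_algC -mul_mpolyC mulr1.
have PhiL g : Phi (L g) = g.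
  apply: mmap_retract => // i; rewrite /X; have [->|->|->] := jcase i.
  - rewrite j10 j20 rmorphM !rmorphB !rmorphM /= !Phik !PhiC PhiX eval2CX eval2X.
    rewrite /linform (sum_other_coords _ hj) -!mul_mpolyC.
    rewrite [X in _ * X](_ : _ = mpolyC 3 (a 0 0) * mX 0); last by ring.
    by rewrite mulrA -mpolyCM mulVf // mpolyC1 mul1r.
  - by rewrite eqxx PhiC eval2X.
  - by rewrite j21 eqxx PhiX.
have P3 : prime_ideal (Phi @^-1` P) by apply: prime_ideal_preim.
have [s [ns hs]] := generic_extension P3 K.
exists s; split.
  by move: ns; rewrite /= PhiC.
move=> c eta kill s0.
have [||zeta hz] := hs (pt2 c eta).
- move=> u; by rewrite /= PhiC; apply: kill.
- exact: s0.
pose psi3 : {rmorphism {poly {poly {poly K}}} -> K} :=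
  @evalp {poly {poly K}} K (pt2 c eta) zeta.
have psiC s' : psi3 s'%:P = pt2 c eta s' by exact: evalpC.
have psiX : psi3 'X = zeta by exact: evalpX.
have psik d : psi3 (k3 d) = d.
  by rewrite /k3 /= psiC pt2C hornerC.
pose x : 'rV[K]_3 := \row_i psi3 (X i).
have psiL g : psi3 (L g) = peval g x by apply: mmap_peval.
have xj1 : x 0 j1 = eta.
  by rewrite mxE /X eqxx psiC pt2X.
have xj2 : x 0 j2 = zeta.
  by rewrite mxE /X eqxx j21 psiX.
exists x; split=> //.
  by move=> g Pg; rewrite -psiL; apply: hz; rewrite /= PhiL.
rewrite (sum_other_coords _ hj) xj1 xj2.
rewrite mxE /X j10 j20 rmorphM !rmorphB !rmorphM /= !psik !psiC psiX pt2C pt2X hornerX.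
by field.
Qed.

End Lift.

(** * Generic linear coordinates *)

Section Transcendental.
Variables (n : nat) (K : closedFieldType) (P : set {mpoly K[n]}) (t : {mpoly K[n]}).
Hypotheses (Pprime : prime_ideal P) (nconst : forall c, ~ P (t - mpolyC n c)).

(** A nonzero [q] splits over the closed field, and the prime P would contain one of the factors t -
    z. *)
Lemma transcendental_mod q : P (horner_alg t q) -> q = 0.
Proof.
move=> Pq; apply/eqP/negPn/negP => q0; move: Pq.
have [r ->] := closed_field_poly_normal q.
rewrite linearZ /= mulr_algl => Pr.
have {Pr} : P (horner_alg t (\prod_(z <- r) ('X - z%:P))).
  rewrite -[X in P X]scale1r -(mulVf (x := lead_coef q)) ?lead_coef_eq0 //.
  by rewrite -scalerA; apply: prime_idealZ.
elim: r => [|z r IH]; first by rewrite big_nil rmorph1 => /(prime_ideal1 Pprime).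
rewrite big_cons rmorphM /= => /(prime_idealP Pprime)[|//].
by rewrite rmorphB /= horner_algX horner_algC -mul_mpolyC mulr1 => /nconst.
Qed.

End Transcendental.

Definition plane_monomials (A : comNzRingType) (t y : A) E : set A :=
  [set w | exists i j, [/\ w = t ^+ i * y ^+ j, (i + j <= E)%N & (j < E)%N]].

Section Integral.
Variables (n : nat) (K : closedFieldType) (P : set {mpoly K[n]}).
Hypothesis Pprime : prime_ideal P.
Variables (t y : {mpoly K[n]}).

(** Substitute t = t' - la y, where t' is the shifted form: the pure power of y gets the coefficient
    (-la)^i, and every other term has a smaller exponent of y. *)
Lemma plane_monomial_shift la i j :
  spn P (plane_monomials (t + la *: y) y (i + j))
    (t ^+ i * y ^+ j - (- la) ^+ i *: y ^+ (i + j)).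
Proof.
set t' := t + la *: y; elim: i => [|i IH].
  by rewrite !expr0 scale1r mul1r subrr; exact: spn0.
rewrite addSn; set m := (i + j)%N in IH *.
have -> : t ^+ i.+1 * y ^+ j - (- la) ^+ i.+1 *: y ^+ m.+1 =
    t' * (t ^+ i * y ^+ j - (- la) ^+ i *: y ^+ m)
    - la *: (y * (t ^+ i * y ^+ j - (- la) ^+ i *: y ^+ m))
    + (- la) ^+ i *: (t' * y ^+ m).
  rewrite /t' !exprS -!mul_mpolyC !mpolyCM !mpolyCN; ring.
apply: spnD => //; first apply: spnB => //.
- apply: spn_mul IH => // _ [a [b [-> ab bm]]]; apply: spn_base => //.
  by exists a.+1, b; rewrite exprS mulrA addSn ltnS ab ltnW.
- apply: spnZ => //; apply: spn_mul IH => // _ [a [b [-> ab bm]]].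
  apply: spn_base => //; exists a, b.+1; rewrite addnS !ltnS ab bm; split=> //.
  by rewrite mulrCA exprS.
- by apply: spnZ => //; apply: spn_base => //; exists 1%N, m; rewrite expr1 add1n !leqnn.
Qed.

(* Noether normalisation: after t -> t + la y with la generic, the leading    *)
(* form of a relation G between t and y has a nonzero coefficient at y^E. *)
Lemma generic_integral (G : {poly {poly K}}) : G != 0 -> P (eval2 t y G) ->
  exists2 h : {poly K}, h != 0 & forall la, h.[la] != 0 ->
    exists2 E, (0 < E)%N & spn P (plane_monomials (t + la *: y) y E) (y ^+ E).
Proof.
move=> G0 PG.
(* [td e] bounds the total degree of [G] by e; the minimal such e is the total degree E. *)
pose td e := `[< forall i j, (e < i + j)%N -> G`_j`_i = 0 >].
have [e0 he0] : exists e, td e.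
  pose s (j : 'I_(size G)) := size G`_j; pose M := (\max_j s j)%N.
  exists (size G + M)%N; apply/asboolP => i j ij.
  have [jG|Gj] := ltnP j (size G); last by rewrite (nth_default _ Gj) coef0.
  have sM : (size (G`_j)%R <= M)%N by exact: (leq_bigmax (F := s) (Ordinal jG)).
  apply: nth_default; apply: leq_trans sM _.
  rewrite -(leq_add2l (size G)); apply: leq_trans (ltnW ij) _.
  by rewrite addnC leq_add2r ltnW.
have [E /asboolP tdE minE] := ex_minnP (ex_intro _ e0 he0).
have [i1 [j1 [ij1 nz1]]] : exists i j, (i + j = E)%N /\ G`_j`_i != 0.
  apply: contrapT => no.
  have z i j : (E <= i + j)%N -> G`_j`_i = 0.
    rewrite leq_eqVlt => /orP[/eqP e|/tdE //].
    by apply: contrapT => /eqP nz; apply: no; exists i, j.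
  case: E tdE minE z {no} => [|E] _ minE z.
    by case/eqP: G0; apply/polyP => j; apply/polyP => i; rewrite !coef0 z.
  by have := minE E; rewrite ltnn => H; suff: false by []; apply: H; apply/asboolP.
(* h(la) is the leading form of [G] at (-la, 1), which is the coefficient of y^E after the shift.
   Since E - j is truncated, the terms with j > E have to be seen to vanish. *)
pose h : {poly K} := \sum_(j < size G) G`_j`_(E - j) *: (- 'X) ^+ (E - j).
have topz j : (E < j)%N -> G`_j`_(E - j) = 0 by move=> Ej; apply: tdE; lia.
exists h.
  have j1G : (j1 < size G)%N.
    rewrite ltnNge; apply: contra nz1 => /leq_sizeP/(_ _ (leqnn _)) ->.
    by rewrite coef0.
  apply/eqP => /(congr1 (fun p : {poly K} => p`_i1)).
  rewrite coef0 coef_sum (bigD1 (Ordinal j1G)) //= big1 => [|j ne].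
    rewrite addr0 (_ : E - j1 = i1)%N; last by rewrite -ij1 addnK.
    rewrite -mulN1r exprMn -signr_odd coefZ.
    rewrite -[_ ^+ odd _]/((-1) ^+ _) -polyCN -polyC_exp mul_polyC coefZ coefXn eqxx mulr1.
    by move/eqP; rewrite mulf_eq0 signr_eq0 orbF (negbTE nz1).
  have [jE|/topz ->] := leqP j E; last by rewrite scale0r coef0.
  rewrite -mulN1r exprMn coefZ -polyCN -polyC_exp mul_polyC coefZ coefXn.
  case: eqP => [e|_]; last by rewrite !mulr0.
  by case/eqP: ne; apply/val_inj => /=; move: ij1 e jE; lia.
move=> la hla.
suff sE : spn P (plane_monomials (t + la *: y) y E) (y ^+ E).
  (* For E = 0 there are no plane monomials, and y^0 = 1 would lie in P. *)
  exists E => //; rewrite lt0n; apply/eqP => E0; apply: (prime_ideal1 Pprime).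
  by move: sE; rewrite E0 expr0; apply: spn_empty => _ [i [j [_ _]]].
have hs : h.[la] = \sum_(j < size G) G`_j`_(E - j) * (- la) ^+ (E - j).
  rewrite /h horner_sum; apply: eq_bigr => j _.
  by rewrite hornerZ horner_exp hornerN hornerX.
have -> : y ^+ E = (h.[la])^-1 *: (h.[la] *: y ^+ E) by rewrite scalerA mulVf ?scale1r.
apply: spnZ => //.
have -> : h.[la] *: y ^+ E = eval2 t y G - (eval2 t y G - h.[la] *: y ^+ E).
  by rewrite subKr.
apply: spnB => //; first exact: spn_ideal.
rewrite eval2E hs scaler_suml -sumrB; apply: spn_sum => // j _.
have -> : horner_alg t G`_j * y ^+ j - (G`_j`_(E - j) * (- la) ^+ (E - j)) *: y ^+ E =
  \sum_(i < (maxn (size (G`_j)%R) (E - j).+1)) G`_j`_i *: (t ^+ i * y ^+ j -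
     ((i == (E - j)%N :> nat)%:R * (- la) ^+ i) *: y ^+ E).
  under [RHS]eq_bigr do rewrite scalerBr; rewrite sumrB.
  rewrite (horner_alg_sum _ (leq_maxl _ (E - j).+1)) mulr_suml; congr (_ - _).
    by apply: eq_bigr => i _; rewrite scalerAl.
  have kN : (E - j < maxn (size (G`_j)%R) (E - j).+1)%N by rewrite leq_maxr.
  rewrite (bigD1 (Ordinal kN)) //= big1 ?addr0 => [|i ne].
    by rewrite eqxx mul1r scalerA.
  rewrite (_ : (i == (E - j)%N :> nat) = false) ?mul0r ?scale0r ?scaler0 //.
  by apply: contraNF ne => /eqP e; apply/eqP/val_inj.
apply: spn_sum => // i _.
have [ijE|/tdE ->] := leqP (i + j) E; last by rewrite scale0r; exact: spn0.
apply: spnZ => //.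
have shift := plane_monomial_shift la i j.
have sub w : spn P (plane_monomials (t + la *: y) y (i + j)) w ->
  spn P (plane_monomials (t + la *: y) y E) w.
  apply: spn_sub => // _ [a [b [-> ab bm]]]; apply: spn_base => //.
  by exists a, b; split=> //; [apply: leq_trans ab ijE | apply: leq_trans bm ijE].
have [eE|neE] := eqVneq (i : nat) (E - j)%N.
  rewrite mul1r; have e : (i + j = E)%N by lia.
  by move: (sub _ shift); rewrite e.
rewrite mul0r scale0r subr0.
rewrite -[_ * _](subrK ((- la) ^+ i *: y ^+ (i + j))); apply: spnD => //; first exact: sub.
apply: spnZ => //; apply: spn_base => //; exists 0%N, (i + j)%N.
by rewrite expr0 mul1r; split=> //; lia.
Qed.

End Integral.

Definition section_bound (K : fieldType) (C : set 'rV[K]_3)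
    (Q : {mpoly K[3 + 1]}) (d : nat) :=
  forall a c, a != 0 -> peval Q (row_mx a c%:M) != 0 ->
  forall s, uniq s -> (forall x, x \in s -> C x /\ \sum_i a 0 i * x 0 i = c) ->
  (size s <= d)%N.

Section Generic.
Variables (K : numClosedFieldType) (Q : {mpoly K[3 + 1]}) (us : seq 'rV[K]_3).
Implicit Types (a w : 'rV[K]_3).

Lemma nonroot (h : {poly K}) : h != 0 -> exists la, h.[la] != 0.
Proof. by move=> h0; have /closed_nonrootP[la /rootP/eqP] := h0; exists la. Qed.

Lemma many_nonroots (h : {poly K}) N : h != 0 ->
  exists s, [/\ uniq s, size s = N & forall x, x \in s -> h.[x] != 0].
Proof.
move=> h0; elim: N => [|N [s [us' <- hs]]]; first by exists [::].
have hs0 : h * \prod_(x <- s) ('X - x%:P) != 0.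
  by rewrite mulf_neq0 // monic_neq0 // monic_prod_XsubC.
have [la] := nonroot hs0; rewrite hornerM mulf_eq0 negb_or => /andP[hla pla].
exists (la :: s); split=> //=.
  rewrite us' andbT; apply: contra pla => las.
  by rewrite -[_ == 0]/(root _ la) root_prod_XsubC.
by move=> x; rewrite inE => /orP[/eqP->|/hs].
Qed.

(** The vectors [us] will be tangents of arcs: a linear form that is nonzero on the tangent is not
    constant along the arc. *)
Definition generic_direction a := exists c,
  [/\ peval Q (row_mx a c%:M) != 0, a 0 0 != 0 &
      forall u, u \in us -> \sum_i a 0 i * u 0 i != 0].

Definition generic_poly : {mpoly K[3 + 1]} :=
  Q * mX (lshift 1 0) * \prod_(u <- us) \sum_i u 0 i *: mX (lshift 1 i).

Lemma peval_generic_poly a c : peval generic_poly (row_mx a c%:M) =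
  peval Q (row_mx a c%:M) * a 0 0 * \prod_(u <- us) \sum_i a 0 i * u 0 i.
Proof.
rewrite /generic_poly !pevalM pevalX row_mxEl; congr (_ * _).
rewrite peval_prod; apply: eq_bigr => u _; rewrite peval_sum.
by apply: eq_bigr => i _; rewrite pevalZ pevalX row_mxEl mulrC.
Qed.

Lemma generic_directionP a :
  generic_direction a <-> exists c, peval generic_poly (row_mx a c%:M) != 0.
Proof.
split=> -[c hc]; exists c; move: hc; rewrite peval_generic_poly.
  move=> [hQ h0 hu]; rewrite !mulf_neq0 // prodf_seq_neq0.
  by apply/allP => u /hu ->; rewrite implybT.
rewrite !mulf_eq0 !negb_or => /andP[/andP[-> ->]].
by rewrite prodf_seq_neq0 => /allP h; split=> // u /h.
Qed.

Lemma generic_direction_exists : Q != 0 -> (forall u, u \in us -> u != 0) ->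
  exists a, generic_direction a.
Proof.
move=> Q0 us0; have W0 : generic_poly != 0.
  rewrite /generic_poly !mulf_neq0 //.
    by rewrite -msize_poly_eq0 msizeX.
  rewrite prodf_seq_neq0; apply/allP => u /us0 u0 /=; apply: contraNneq u0.
  move=> /(congr1 (fun p => mcoeff (mnm1 _) p)) h; apply/eqP/rowP => i.
  have := h (lshift 1 i); rewrite mcoeff0 raddf_sum (bigD1 i) //= big1 ?addr0.
    by rewrite mcoeffZ mcoeffX eqxx mulr1 mxE.
  move=> j ji; rewrite mcoeffZ mcoeffX.
  case: eqP => [e|]; last by rewrite mulr0.
  have /mnmP/(_ (lshift 1 i)) := e; rewrite !mnm1E eqxx (inj_eq (@lshift_inj _ _)).
  by rewrite (negbTE ji).
have [x hx] : exists x, peval generic_poly x != 0.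
  apply: contrapT => no; case/eqP: W0; apply: mpoly_vanish => x.
  by apply: contrapT => /eqP hx; apply: no; exists x.
exists (lsubmx x); apply/generic_directionP; exists (rsubmx x 0 0).
rewrite (_ : row_mx _ _ = x) // -[RHS]hsubmxK; congr row_mx.
by apply/rowP => i; rewrite !ord1 !mxE eqxx mulr1n.
Qed.

Lemma generic_direction_line a w : generic_direction a ->
  exists2 h : {poly K}, h != 0 & forall la, h.[la] != 0 -> generic_direction (a + la *: w).
Proof.
move=> /generic_directionP[c hc].
exists (restr (row_mx a c%:M) (row_mx w 0) generic_poly).
  apply: contraNneq hc => h; rewrite -[row_mx a _]addr0 -(scale0r (row_mx w 0)).
  by rewrite -restrE h horner0.
move=> la; rewrite restrE => h; apply/generic_directionP; exists c.
by move: h; rewrite scale_row_mx add_row_mx scaler0 addr0.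
Qed.

Lemma generic_parameter a : generic_direction a ->
  exists2 h : {poly K}, h != 0 & forall c, h.[c] != 0 -> peval Q (row_mx a c%:M) != 0.
Proof.
move=> [c [hc _ _]]; exists (restr (row_mx a 0) (row_mx 0 1%:M) Q).
  apply: contraNneq hc => h; rewrite -(horner0 c) -h restrE.
  by rewrite scale_row_mx add_row_mx scaler0 addr0 add0r scalemx1.
by move=> e; rewrite restrE scale_row_mx add_row_mx scaler0 addr0 add0r scalemx1.
Qed.

Lemma generic_neq0 a : generic_direction a -> a != 0.
Proof. by move=> [c [_ h _]]; apply: contraNneq h => ->; rewrite mxE. Qed.

End Generic.

Lemma linform_shift (K : fieldType) (n : nat) (a : 'rV[K]_n) la j :
  linform (a + la *: delta_mx 0 j) = linform a + la *: mX j.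
Proof.
rewrite /linform (bigD1 j) //= [X in _ = X + _](bigD1 j) //= addrAC !mxE !eqxx.
rewrite mulr1 scalerDl; congr (_ + _); apply: eq_bigr => i ne.
by rewrite !mxE (negbTE ne) andbF mulr0 addr0.
Qed.

Section PlaneRelation.
Variables (K : numClosedFieldType) (C : set 'rV[K]_3) (Q : {mpoly K[3 + 1]}) (d : nat).
Hypothesis hsec : section_bound C Q d.
Variables (P : set {mpoly K[3]}) (us : seq 'rV[K]_3).
Hypotheses (Pprime : prime_ideal P) (PC : zeros P `<=` C).

(** If [t] and [y] were independent modulo P, every point of the (t, y)-plane off s = 0 would lift
    to a zero of P; over one generic c this gives d + 1 points of C in a generic hyperplane. *)
Lemma plane_relation a j1 j2 : other_coords j1 j2 -> generic_direction Q us a ->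
  exists2 G, G != 0 & P (eval2 (linform a) (mX j1) G).
Proof.
move=> hj ga; have [_ [_ a0 _]] := ga; apply: contrapT => no.
have inj G : P (eval2 (linform a) (mX j1) G) -> G = 0.
  by move=> PG; apply/eqP/negPn/negP => G0; apply: no; exists G.
have [s [ns lift]] := lift_zeros Pprime a0 hj.
have s0 : s != 0 by apply: contra_notN ns => /eqP ->; rewrite rmorph0; apply: prime_ideal0.
have [h h0 hh] := generic_parameter ga.
have ls0 : lead_coef s != 0 by rewrite lead_coef_eq0.
have [c] := nonroot (mulf_neq0 h0 ls0); rewrite hornerM mulf_eq0 negb_or => /andP[/hh hc sc].
have sc0 : map_poly (horner_eval c) s != 0.
  apply: contraNneq sc => e; have := congr1 (fun p : {poly K} => p`_(size s).-1) e.
  by rewrite coef_map coef0 => /eqP.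
have [etas [ue se he]] := many_nonroots d.+1 sc0.
have /choice[f hf] : forall eta, exists x, eta \in etas ->
    [/\ zeros P x, \sum_i a 0 i * x 0 i = c & x 0 j1 = eta].
  move=> eta; have [hin|] := boolP (eta \in etas); last by exists 0.
  have [|x hx] := lift c eta _ (he _ hin); last by exists x.
  by move=> G /inj ->; rewrite rmorph0.
have := hsec (generic_neq0 ga) hc (s := map f etas).
rewrite size_map se ltnn => H; suff: false by []; apply: H.
  by rewrite map_inj_in_uniq // => e1 e2 /hf[_ _ h1] /hf[_ _ h2] e; rewrite -h1 -h2 e.
by move=> _ /mapP[eta /hf[/PC Cx e _] ->].
Qed.

Lemma integral_choice a j1 j2 : other_coords j1 j2 -> generic_direction Q us a ->
  exists la E, let a' := a + la *: delta_mx 0 j1 in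
    [/\ generic_direction Q us a', (0 < E)%N &
        spn P (plane_monomials (linform a') (mX j1) E) (mX j1 ^+ E)].
Proof.
move=> hj ga; have [G G0 PG] := plane_relation hj ga.
have [h h0 hE] := generic_integral Pprime G0 PG.
have [h' h'0 hg] := generic_direction_line (delta_mx 0 j1) ga.
have [la] := nonroot (mulf_neq0 h0 h'0).
rewrite hornerM mulf_eq0 negb_or => /andP[/hE[E E0 sE] /hg ga'].
by move: sE; rewrite -linform_shift => sE; exists la, E; split.
Qed.

End PlaneRelation.

(** * Normal forms modulo P and the Hilbert function *)

Definition box_monomials (A : comNzRingType) (t y z : A) m e2 e3 : set A :=
  [set w | exists i j k, [/\ w = t ^+ i * y ^+ j * z ^+ k, (i + j + k <= m)%N,
                             (j < e2)%N & (k < e3)%N]].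

(** A slab bounds the exponent of [t] alone: this is what is left after clearing denominators in
    [t], and its monomials are easily counted. *)
Definition slab_monomials (A : comNzRingType) (t y z : A) m e2 e3 : set A :=
  [set w | exists i j k, [/\ w = t ^+ i * y ^+ j * z ^+ k, (i <= m)%N,
                             (j < e2)%N & (k < e3)%N]].

Section Filtration.
Variables (K : fieldType) (P : set {mpoly K[3]}) (a : 'rV[K]_3) (mu : K).
Variables (E2 E3 : nat).
Local Notation t := (linform a).
Local Notation y := (mX 1 : {mpoly K[3]}).
Local Notation z := (mX 2%:R : {mpoly K[3]}).
Hypotheses (Pprime : prime_ideal P) (a0 : a 0 0 != 0) (E20 : (0 < E2)%N) (E30 : (0 < E3)%N).
Hypothesis inty : spn P (plane_monomials (t - mu *: z) y E2) (y ^+ E2).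
Hypothesis intz : spn P (plane_monomials t z E3) (z ^+ E3).

Local Notation box m := (spn P (box_monomials t y z m E2 E3)).

Lemma box_leq m m' w : (m <= m')%N -> box m w -> box m' w.
Proof.
move=> mm; apply: spn_sub => // _ [i [j [k [-> ijk jE kE]]]]; apply: spn_base => //.
by exists i, j, k; split=> //; apply: leq_trans mm.
Qed.

Lemma box_t m w : box m w -> box m.+1 (t * w).
Proof.
apply: spn_mul => // _ [i [j [k [-> ijk jE kE]]]]; apply: spn_base => //.
by exists i.+1, j, k; rewrite !mulrA -exprS !addSn ltnS.
Qed.

Lemma box_z m w : box m w -> box m.+1 (z * w).
Proof.
apply: spn_mul => // _ [i [j [k [-> ijk jE kE]]]].
rewrite mulrCA -exprS; move: kE; rewrite leq_eqVlt => /orP[/eqP kE|kE]; last first.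
  by apply: spn_base => //; exists i, j, k.+1; rewrite addnS ltnS.
rewrite kE; apply: spn_mul intz => // _ [p [q [-> pq qE]]]; apply: spn_base => //.
exists (i + p)%N, j, q; rewrite exprD; split=> //; first by ring.
by move: pq ijk; rewrite -kE; lia.
Qed.

Lemma box_iter (x : {mpoly K[3]}) : (forall m w, box m w -> box m.+1 (x * w)) ->
  forall n m w, box m w -> box (m + n) (x ^+ n * w).
Proof.
move=> h; elim=> [|n IH] m w bw; first by rewrite expr0 mul1r addn0.
by rewrite exprS -mulrA addnS; apply/h/IH.
Qed.

Lemma box_t1 m w : box m w -> box m.+1 ((t - mu *: z) * w).
Proof.
move=> bw; rewrite mulrBl -scalerAl; apply: spnB => //; first exact: box_t.
by apply: spnZ => //; apply: box_z.
Qed.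

(** When the exponent of y reaches E2, [inty] rewrites y^E2 in t - mu z and y without raising the
    total degree; the powers of t - mu z, z and t are then absorbed by the preceding lemmas. *)
Lemma box_y m w : box m w -> box m.+1 (y * w).
Proof.
apply: spn_mul => // _ [i [j [k [-> ijk jE kE]]]].
move: jE; rewrite leq_eqVlt => /orP[/eqP jE|jE]; last first.
  apply: spn_base => //; exists i, j.+1, k; rewrite !addnS addSn ltnS; split=> //.
  by rewrite exprS; ring.
have -> : y * (t ^+ i * y ^+ j * z ^+ k) = (t ^+ i * z ^+ k) * y ^+ E2.
  by rewrite -jE exprS; ring.
apply: spn_mul inty => // _ [p [q [-> pq qE]]].
have bq : box q (y ^+ q).
  by apply: spn_base => //; exists 0%N, q, 0%N; rewrite !expr0 mul1r mulr1 add0n addn0.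
have := box_iter box_t i (box_iter box_z k (box_iter box_t1 p bq)).
by rewrite -!mulrA; apply: box_leq; move: pq ijk; rewrite -jE; lia.
Qed.

Lemma box_x m w : box m w -> box m.+1 (mX 0 * w).
Proof.
move=> bw; have -> : mX 0 = (a 0 0)^-1 *: (t - a 0 1 *: y - a 0 2%:R *: z).
  rewrite /linform (@sum_other_coords _ _ 1 2%:R) //.
  by rewrite addrAC addrK [_ + _ - _]addrK scalerA mulVf // scale1r.
rewrite -scalerAl !mulrBl -!scalerAl; apply: spnZ => //.
apply: spnB => //; last by apply: spnZ => //; apply: box_z.
by apply: spnB => //; [apply: box_t | apply: spnZ => //; apply: box_y].
Qed.

Lemma filtration m w : deg_le m w -> box m w.
Proof.
move=> dw; rewrite [w]mpolyE; rewrite big_seq; apply: spn_sum => // M Mw.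
apply: spnZ => //; have := msize_mdeg_lt Mw => Mm.
apply: (@box_leq (mdeg M)); first by rewrite -ltnS (leq_trans Mm).
rewrite [mpolyX _ M]mpolyXE_id mdegE !big_ord_recl !big_ord0 mulr1 addn0.
rewrite (_ : lift ord0 (lift ord0 ord0) = 2%:R); last exact: val_inj.
rewrite (_ : lift ord0 ord0 = 1); last exact: val_inj.
have b1 : box 0 1.
  by apply: spn_base => //; exists 0%N, 0%N, 0%N; rewrite !expr0 !mulr1.
have := box_iter box_x (M ord0) (box_iter box_y (M 1) (box_iter box_z (M 2%:R) b1)).
rewrite mulr1 add0n => h; apply: box_leq h.
by rewrite addnC (addnC (M 2%:R)).
Qed.

End Filtration.

(** Multiplication by [D] is injective modulo the prime P, and there are at most (m + c + 1) * e2 *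
    e3 slab monomials. *)
Lemma growth_of_span (K : fieldType) (P : set {mpoly K[3]}) (t y z D : {mpoly K[3]}) c e2 e3 :
  prime_ideal P -> ~ P D ->
  (forall m w, deg_le m w -> spn P (slab_monomials t y z (m + c) e2 e3) (D * w)) ->
  growth P (e2 * e3).
Proof.
move=> Pprime PD h; exists c.+1 => m M w NM dw.
set N := (_ * _)%N in NM.
pose b (n : 'I_N) := t ^+ (n %/ (e2 * e3)) * y ^+ (n %% (e2 * e3) %/ e3) *
  z ^+ (n %% (e2 * e3) %% e3).
have sb i : spn P (range b) (D * w i).
  apply: spn_sub (h _ _ (dw i)) => // _ [p [j [k [-> pm je ke]]]].
  apply: spn_base => //.
  have jk : (j * e3 + k < e2 * e3)%N by nia.
  have lt : (p * (e2 * e3) + (j * e3 + k) < N)%N.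
    by rewrite /N addnS; move: jk pm; move: (e2 * e3)%N (j * e3 + k)%N; nia.
  exists (Ordinal lt) => //; rewrite /b /= modnMDl modn_small //.
  rewrite divnMDl ?(leq_ltn_trans _ jk) // (divn_small jk) addn0.
  by rewrite divnMDl ?(leq_ltn_trans _ ke) // divn_small // addn0 modnMDl modn_small.
have [v [v0 Pv]] := spn_dependent Pprime NM sb.
exists v; split=> //; have : P (D * \sum_i v i *: w i).
  by move: Pv; congr P; rewrite mulr_sumr; apply: eq_bigr => i _; rewrite scalerAr.
by case/(prime_idealP Pprime).
Qed.

(** * Generic hyperplane sections *)

Lemma evalp_comp (S A : comNzRingType) (f : {rmorphism S -> A}) z r w :
  evalp f z (r \Po w) = evalp f (evalp f z w) r.
Proof. by rewrite /evalp /= !horner_evalE map_comp_poly horner_comp. Qed.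

Lemma peval_eval2 (n : nat) (K : fieldType) (t y : {mpoly K[n]}) r x :
  peval (eval2 t y r) x = pt2 (peval t x) (peval y x) r.
Proof.
have pa q : peval (horner_alg t q) x = q.[peval t x].
  rewrite (horner_alg_sum _ (leqnn _)) peval_sum horner_coef.
  by apply: eq_bigr => i _; rewrite pevalZ pevalXn.
rewrite eval2E peval_sum /pt2 /evalp /= horner_evalE (horner_coef_wide _ (size_poly _ _)).
by apply: eq_bigr => i _; rewrite pevalM pa pevalXn coef_map.
Qed.

Lemma pt20 (K : fieldType) (c : K) r : pt2 c 0 r = (r`_0).[c].
Proof. by rewrite /pt2 /evalp /= horner_evalE horner_coef0 coef_map. Qed.

Lemma eval2_const (K : fieldType) (A : comAlgType K) (t g : A) r :
  eval2 t g r = eval2 t g (drop_poly 1 r) * g + horner_alg t r`_0.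
Proof.
have {1}-> : r = drop_poly 1 r * 'X + (r`_0)%:P.
  by apply/polyP => -[|i]; rewrite coefD coefMX coefC /= ?add0r // coef_drop_poly addn1 addr0.
by rewrite rmorphD rmorphM /= eval2X eval2C.
Qed.

Lemma deriv_neq0 (K : numFieldType) (M : {poly {poly K}}) : (1 < size M)%N -> M^`() != 0.
Proof.
move=> sM; apply/eqP => /(congr1 (fun p : {poly {poly K}} => p`_(size M).-2)).
rewrite coef0 coef_deriv prednK; last by rewrite -ltnS prednK // ltnW.
rewrite -lead_coefE -(scaler_nat (R := K)) => /eqP.
rewrite scaler_eq0 pnatr_eq0 lead_coef_eq0 -size_poly_eq0.
by move: sM; case: (size M) => [|[|k]].
Qed.

Section Fibre.
Variables (K : numClosedFieldType) (C : set 'rV[K]_3) (Q : {mpoly K[3 + 1]}) (d : nat).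
Hypothesis hsec : section_bound C Q d.
Variables (P : set {mpoly K[3]}) (us : seq 'rV[K]_3) (E : nat).
Hypotheses (Pprime : prime_ideal P) (PC : zeros P `<=` C) (Pgrowth : growth P E).
Hypothesis nconst : forall a c, generic_direction Q us a -> ~ P (linform a - mpolyC 3 c).

(* The nonvanishing conditions that make the fibre over c generic are turned  *)
(* into a condition on c alone by growth_relation. *)
Lemma generic_fibre a j1 j2 g : other_coords j1 j2 -> generic_direction Q us a -> ~ P g ->
  exists (M : {poly {poly K}}) (h : {poly K}),
    [/\ P (eval2 (linform a) (mX j1) M), lead_coef M != 0, (1 < size M)%N, h != 0 &
      forall c, h.[c] != 0 -> exists xs, [/\ uniq xs, size xs = (size M).-1 &
        forall x, x \in xs -> [/\ zeros P x, \sum_i a 0 i * x 0 i = c & peval g x != 0]]].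
Proof.
move=> hj ga ng; have [_ [_ a0 _]] := ga.
set t := linform a; set y := mX j1.
have tr q : P (horner_alg t q) -> q = 0.
  by apply: transcendental_mod => // c; apply: nconst.
have [G G0 PG] := plane_relation hsec Pprime PC hj ga.
have P2 : prime_ideal (eval2 t y @^-1` P) by apply: prime_ideal_preim.
have P2C q : (eval2 t y @^-1` P) q%:P -> q = 0 by rewrite /= eval2C => /tr.
have nG : ~ (eval2 t y @^-1` P) (G`_(size G).-1)%:P.
  by move=> /P2C/eqP; rewrite -lead_coefE lead_coef_eq0; apply/negP.
(* As P contains no nonzero polynomial in [t], [M] is a minimal polynomial of [y] over K(t), cleared
   of denominators. *)
have [M [PM nM min]] := minimal_lead P2 PG nG.
have lM : lead_coef M != 0.
  apply: contra_notN nM => /eqP ->; rewrite /= rmorph0.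
  exact: prime_ideal0.
have sM := minimal_size PM nM.
(* Separability: the derivative is shorter than [M], and in P it would have to be zero. *)
have nD : ~ P (eval2 t y M^`()).
  move=> PD; case/eqP: (deriv_neq0 sM); apply/polyP => i; rewrite coef0.
  by apply: P2C; apply: min => //; apply: lt_size_deriv; rewrite -lead_coef_eq0.
have [s [ns lift]] := lift_zeros Pprime a0 hj.
have nsD : ~ P (eval2 t y (s * M^`())) by rewrite rmorphM => /(prime_idealP Pprime)[].
(* If s * M' or g vanished at a point over c, its relation with [t] would force the constant term of
   that relation to vanish at c. So [r] secures both lifting and simple roots, and [r'] keeps the
   points off g = 0. *)
have [r r0 Pr] := growth_relation Pprime Pgrowth (deg_le_linform a) nsD.
have [r' r'0 Pr'] := growth_relation Pprime Pgrowth (deg_le_linform a) ng.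
exists M, (lead_coef M * r`_0 * r'`_0); split=> //; first by rewrite !mulf_neq0.
move=> c; rewrite !hornerM !mulf_eq0 !negb_or => /andP[/andP[lc rc] r'c].
pose N := map_poly (horner_eval c) M.
have sN : size N = size M by rewrite size_map_poly_id0.
have kill eta : root N eta -> forall G, P (eval2 t y G) -> pt2 c eta G = 0.
  move=> re F PF.
  have kc q : (eval2 t y @^-1` P) q%:P -> horner_eval c q = 0.
    by move=> /P2C ->; rewrite horner_evalE horner0.
  exact: (minimal_specialization P2 min kc PM lc re PF).
have nz eta : root N eta -> pt2 c eta (s * M^`()) != 0.
  move=> re; apply: contraNneq rc => e.
  have := kill eta re (r \Po (s * M^`())).
  rewrite /eval2 evalp_comp => /(_ Pr).
  by rewrite /pt2 evalp_comp -/(pt2 c eta _) e -/(pt2 c 0 _) pt20 => ->.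
have [rs eN] := closed_field_poly_normal N.
have lN : lead_coef N != 0 by rewrite lead_coef_eq0 -size_poly_eq0 sN -lt0n ltnW.
have rootN eta : (eta \in rs) = root N eta by rewrite eN rootZ // root_prod_XsubC.
have urs : uniq rs.
  rewrite -separable_prod_XsubC unlock -(coprimepZl _ _ lN).
  rewrite -[X in coprimep _ X](scale1r) -(mulVf lN) -scalerA -derivZ -eN.
  rewrite coprimepZr ?invr_eq0 //; apply/Pdiv.ClosedField.coprimepP => eta re.
  by have := nz _ re; rewrite rmorphM mulf_eq0 negb_or => /andP[_]; rewrite deriv_map.
have srs : size rs = (size M).-1.
  by rewrite -sN eN size_scale // size_prod_XsubC.
have /choice[f hf] : forall eta, exists x, eta \in rs ->
    [/\ zeros P x, \sum_i a 0 i * x 0 i = c & x 0 j1 = eta].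
  move=> eta; have [hin|] := boolP (eta \in rs); last by exists 0.
  rewrite rootN in hin.
  have [||x hx] := lift c eta; last by exists x.
    exact: kill.
  by have := nz _ hin; rewrite rmorphM mulf_eq0 negb_or => /andP[].
exists (map f rs); split; last 1 first.
- move=> _ /mapP[eta /hf[fP fc _] ->]; split=> //.
  apply: contraNneq r'c => g0; have := fP _ Pr'.
  by rewrite peval_eval2 peval_linform fc g0 pt20 => ->.
- by rewrite map_inj_in_uniq // => e1 e2 /hf[_ _ h1] /hf[_ _ h2] e; rewrite -h1 -h2 e.
- by rewrite size_map.
Qed.

(** The degree of [M] in [y] is the size of a generic fibre, whose points lie on C in one generic
    hyperplane. *)
Lemma min_poly_degree a j1 j2 : other_coords j1 j2 -> generic_direction Q us a ->
  exists M : {poly {poly K}}, [/\ P (eval2 (linform a) (mX j1) M), lead_coef M != 0,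
    (1 < size M)%N & ((size M).-1 <= d)%N].
Proof.
move=> hj ga.
have [M [h [PM lM sM h0 fib]]] := generic_fibre hj ga (prime_ideal1 Pprime).
exists M; split=> //.
have [h' h'0 hh'] := generic_parameter ga.
have [c] := nonroot (mulf_neq0 h0 h'0).
rewrite hornerM mulf_eq0 negb_or => /andP[/fib[xs [uxs <- hxs]] /hh' hc].
apply: (hsec (generic_neq0 ga) hc) => // x /hxs[/PC Cx e _]; by split.
Qed.

End Fibre.

(** * Clearing denominators, the uniform slope and the number of components *)

Section ClearDenominators.
Variables (n : nat) (K : fieldType) (P : set {mpoly K[n]}) (t y : {mpoly K[n]}).
Variable M : {poly {poly K}}.
Hypotheses (Pprime : prime_ideal P) (PM : P (eval2 t y M)) (sM : (1 < size M)%N).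

Definition strip_monomials (A : comNzRingType) (t y : A) c e : set A :=
  [set w | exists i j, [/\ w = t ^+ i * y ^+ j, (i <= c)%N & (j < e)%N]].

Local Notation e := (size M).-1.
Local Notation strip c := (spn P (strip_monomials t y c e)).

Lemma strip_poly c (q : {poly K}) w : strip c w -> strip (c + size q) (horner_alg t q * w).
Proof.
rewrite (horner_alg_sum _ (leqnn _)) mulr_suml => sw; apply: spn_sum => // i _.
rewrite -scalerAl; apply: spnZ => //; apply: spn_mul sw => // _ [a [b [-> ac be]]].
apply: spn_base => //; exists (i + a)%N, b; rewrite exprD mulrA; split=> //.
by rewrite addnC leq_add // ltnW.
Qed.

Lemma strip_leq c c' w : (c <= c')%N -> strip c w -> strip c' w.
Proof.
move=> cc; apply: spn_sub => // _ [i [j [-> ic je]]]; apply: spn_base => //.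
by exists i, j; split=> //; apply: leq_trans cc.
Qed.

(** Each reduction of the e-th power of [y] by [M] costs one factor [lead_coef M]. *)
Lemma clear_power j : exists k c, strip c (horner_alg t (lead_coef M ^+ k) * y ^+ j).
Proof.
elim: j => [|j [k [c IH]]].
  exists 0%N, 0%N; rewrite expr0 rmorph1 mul1r; apply: spn_base => //.
  by exists 0%N, 0%N; rewrite !expr0 mulr1; split=> //; rewrite -ltnS prednK // ltnW.
pose B := \max_(l < size M) size (M`_l)%R.
exists k.+1, (c + B)%N.
have -> : horner_alg t (lead_coef M ^+ k.+1) * y ^+ j.+1 =
    (horner_alg t (lead_coef M) * y) * (horner_alg t (lead_coef M ^+ k) * y ^+ j).
  by rewrite exprS rmorphM exprS; ring.
have leB (l : 'I_(size M)) : (size (M`_l)%R <= B)%N.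
  exact: (leq_bigmax (F := fun l : 'I_(size M) => size (M`_l)%R)).
have szM : size M = e.+1 by rewrite prednK // ltnW.
have le_e : (e < size M)%N by rewrite szM.
apply: spn_mul IH => // _ [a [b [-> ac be]]].
have tb (l : 'I_(size M)) b' : (b' < e)%N ->
    strip (c + B) (horner_alg t M`_l * (t ^+ a * y ^+ b')).
  move=> b'e; apply: (@strip_leq (c + size (M`_l)%R)); first by rewrite leq_add2l.
  by apply: strip_poly; apply: spn_base => //; exists a, b'.
have [b1|] := ltnP b.+1 e.
  have -> : horner_alg t (lead_coef M) * y * (t ^+ a * y ^+ b) =
     horner_alg t M`_(Ordinal le_e) * (t ^+ a * y ^+ b.+1).
    by rewrite exprS /= -lead_coefE; ring.
  exact: tb.
move=> eb; have {eb} be' : b.+1 = e by apply/eqP; rewrite eqn_leq be.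
have -> : horner_alg t (lead_coef M) * y * (t ^+ a * y ^+ b) =
    t ^+ a * eval2 t y M - \sum_(l < e) horner_alg t M`_l * (t ^+ a * y ^+ l).
  have -> : eval2 t y M = \sum_(l < e) horner_alg t M`_l * y ^+ l
      + horner_alg t (lead_coef M) * y ^+ e.
    rewrite eval2E -(big_mkord xpredT (fun l => horner_alg t M`_l * y ^+ l)).
    by rewrite [X in index_iota 0 X]szM big_nat_recr //= big_mkord -lead_coefE.
  rewrite mulrDr mulr_sumr -be' exprS.
  under eq_bigr do rewrite mulrCA.
  by rewrite [X in X - _]addrC addrK; ring.
apply: spnB => //; first by apply: spn_ideal; apply: prime_idealMl.
by apply: spn_sum => // l _; apply: (tb (widen_ord (leq_pred _) l)).
Qed.

Lemma clear_denominators N :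
  lead_coef M != 0 -> exists D c, D != 0 /\
  forall j, (j < N)%N -> strip c (horner_alg t D * y ^+ j).
Proof.
move=> lM; elim: N => [|N [D [c [D0 h]]]]; first by exists 1, 0%N; rewrite oner_neq0.
have [k [c' h']] := clear_power N.
exists (lead_coef M ^+ k * D), (c + c' + size (lead_coef M ^+ k)%R + size D)%N.
split=> [|j]; first by rewrite mulf_neq0 // expf_neq0.
rewrite ltnS leq_eqVlt rmorphM => /orP[/eqP ->|jN].
  rewrite mulrAC mulrC; apply: strip_leq (strip_poly D h').
  by rewrite leq_add2r addnAC leq_addl.
rewrite -mulrA; apply: strip_leq (strip_poly (lead_coef M ^+ k) (h _ jN)).
lia.
Qed.

End ClearDenominators.

Lemma growth_leq (n : nat) (K : fieldType) (P : set {mpoly K[n]}) S S' :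
  (S <= S')%N -> growth P S -> growth P S'.
Proof.
move=> SS [C hC]; exists C => m M w NM; apply: hC.
by apply: leq_ltn_trans NM; rewrite leq_mul2r SS orbT.
Qed.

Section Degree.
Variables (K : numClosedFieldType) (C : set 'rV[K]_3) (Q : {mpoly K[3 + 1]}) (d : nat).
Hypotheses (hsec : section_bound C Q d) (Q0 : Q != 0).

(** Noether normalisation gives a slope E2 * E3 with no control on its size. This makes
    [generic_fibre] available, by which two coordinates have degree at most d over K(t); after
    clearing denominators only d * d pairs of exponents remain. *)
Lemma uniform_growth (P : set {mpoly K[3]}) (us : seq 'rV[K]_3) :
  prime_ideal P -> zeros P `<=` C -> (forall u, u \in us -> u != 0) ->
  (forall a c, generic_direction Q us a -> ~ P (linform a - mpolyC 3 c)) ->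
  growth P (d * d).
Proof.
move=> Pprime PC us0 nconst.
have [a0 ga0] := generic_direction_exists Q0 us0.
have o12 : other_coords 1 2%:R by [].
have o21 : other_coords 2%:R 1 by [].
have [la [E2 [ga1 E20 inty]]] := integral_choice hsec Pprime PC o12 ga0.
have [mu [E3 [ga E30 intz]]] := integral_choice hsec Pprime PC o21 ga1.
set a1 := a0 + _ in ga1 inty ga intz; set a := a1 + _ in ga intz.
set t := linform a in intz.
(* The second shift changes the linear form, so the integrality of the coordinate 1 now refers to t
   - mu z. *)
have et : linform a1 = t - mu *: mX 2%:R by rewrite /t /a (linform_shift a1) addrK.
rewrite et in inty.
have [_ [_ aa0 _]] := ga.
have filt := filtration Pprime aa0 E20 E30 inty intz.
have gE : growth P (E2 * E3).
  apply: (growth_of_span Pprime (prime_ideal1 Pprime) (t := t) (y := mX 1)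
    (z := mX 2%:R) (c := 0%N)) => m w dw.
  rewrite mul1r addn0; apply: spn_sub (filt _ _ dw) => // _ [i [j [k [-> ijk jE kE]]]].
  apply: spn_base => //; exists i, j, k; split=> //.
  by apply: leq_trans ijk; rewrite -addnA leq_addr.
have tr q : P (horner_alg t q) -> q = 0.
  by apply: transcendental_mod => // c; apply: nconst.
have [M2 [PM2 lM2 sM2 dM2]] := min_poly_degree hsec Pprime PC gE nconst o12 ga.
have [M3 [PM3 lM3 sM3 dM3]] := min_poly_degree hsec Pprime PC gE nconst o21 ga.
have [D2 [c2 [D20 h2]]] := clear_denominators Pprime PM2 sM2 E2 lM2.
have [D3 [c3 [D30 h3]]] := clear_denominators Pprime PM3 sM3 E3 lM3.
apply: (growth_leq (leq_mul dM2 dM3)).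
apply: (growth_of_span Pprime (t := t) (y := mX 1) (z := mX 2%:R)
  (D := horner_alg t (D2 * D3)) (c := (c2 + c3)%N)).
  by move=> /tr/eqP; rewrite mulf_eq0 (negbTE D20) (negbTE D30).
move=> m w dw; apply: spn_mul (filt _ _ dw) => // _ [i [j [k [-> ijk jE kE]]]].
have -> : horner_alg t (D2 * D3) * (t ^+ i * mX 1 ^+ j * mX 2%:R ^+ k) =
    t ^+ i * (horner_alg t D2 * mX 1 ^+ j) * (horner_alg t D3 * mX 2%:R ^+ k).
  by rewrite rmorphM /=; ring.
apply: spn_mul (h3 _ kE) => // _ [p [q [-> pc qe]]].
have -> : t ^+ i * (horner_alg t D2 * mX 1 ^+ j) * (t ^+ p * mX 2%:R ^+ q) =
    (t ^+ (i + p) * mX 2%:R ^+ q) * (horner_alg t D2 * mX 1 ^+ j).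
  by rewrite mulrACA -exprD -mulrA [X in _ * X]mulrC.
apply: spn_mul (h2 _ jE) => // _ [p' [q' [-> pc' qe']]].
apply: spn_base => //; exists (i + p + p')%N, q', q; split=> //.
  by rewrite mulrACA -exprD [X in _ * X]mulrC mulrA.
move: ijk pc pc'; lia.
Qed.

(* A generic hyperplane meets every zeros (P i) away from all the others. *)
Lemma prime_count k (P : 'I_k -> set {mpoly K[3]}) (u : 'I_k -> 'rV[K]_3) :
  injective P -> (forall i, prime_ideal (P i)) -> (forall i, zeros (P i) `<=` C) ->
  (forall i, u i != 0) ->
  (forall i (a : 'rV[K]_3) c, \sum_j a 0 j * u i 0 j != 0 -> ~ P i (linform a - mpolyC 3 c)) ->
  (k <= d)%N.
Proof.
move=> injP Pprime PC u0 nconst; pose us := [seq u i | i <- enum 'I_k].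
have us0 v : v \in us -> v != 0 by move=> /mapP[i _ ->].
have nc i a c : generic_direction Q us a -> ~ P i (linform a - mpolyC 3 c).
  by move=> [_ [_ _ h]]; apply/nconst/h/map_f; rewrite mem_enum.
have growthP i : growth (P i) (d * d).
  exact: uniform_growth (Pprime i) (PC i) us0 (nc i).
have [a ga] := generic_direction_exists Q0 us0.
have [s hs] : exists s : 'I_k -> 'I_k -> {mpoly K[3]},
    forall i j, i != j -> P j (s i j) /\ ~ P i (s i j).
  suff h i j : exists g, i != j -> P j g /\ ~ P i g.
    exists (fun i j => projT1 (cid (h i j))) => i j.
    exact: (projT2 (cid (h i j))).
  have [->|ij] := eqVneq i j; first by exists 0.
  apply: contrapT => no.
  have Pji g : P j g -> P i g.
    by move=> Pg; apply: contrapT => ng; apply: no; exists g.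
  have [g Pg ng] : exists2 g, P i g & ~ P j g.
    apply: contrapT => no'; case/eqP: ij; apply: injP; apply/seteqP; split=> // g Pg.
    by apply: contrapT => ng; apply: no'; exists g.
  (* P j cannot be strictly contained in P i: the relation of the linear form with [g] modulo P j
     would put a nonzero polynomial in that form into P i. *)
  have [r r0 Pr] := growth_relation (Pprime j) (growthP j) (deg_le_linform a) ng.
  move/Pji: Pr; rewrite eval2_const => Pr; case/eqP: r0.
  apply: (transcendental_mod (Pprime i) (nc i a ^~ ga)).
  rewrite -[horner_alg _ _](addKr (eval2 (linform a) g (drop_poly 1 r) * g)) addrC.
  by apply: prime_idealB => //; apply: prime_idealMl.
(* S i lies in every P j with j != i but not in P i, so a zero of P i at which it is nonzero is a
   zero of no other P j. *)
pose S i := \prod_(j | i != j) s i j.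
have nS i : ~ P i (S i).
  by move=> /(prime_ideal_prod (Pprime i))[j ij]; have [] := hs _ _ ij.
have PS i j : i != j -> P j (S i).
  move=> ij; rewrite /S (bigD1 j) //=; apply: prime_idealMr => //.
  by have [] := hs _ _ ij.
have o12 : other_coords 1 2%:R by [].
have fib i : exists2 h : {poly K}, h != 0 & forall c, h.[c] != 0 ->
    exists x, [/\ zeros (P i) x, \sum_j a 0 j * x 0 j = c & peval (S i) x != 0].
  have [M [h [_ _ sM h0 hh]]] :=
    generic_fibre hsec (Pprime i) (PC i) (growthP i) (nc i) o12 ga (nS i).
  exists h => // c /hh[[|x xs] [_]] /=; first by case: (size M) sM => [|[]].
  by move=> _ hx; exists x; apply: hx; rewrite mem_head.
have /choice[h hh] : forall i, exists h : {poly K}, h != 0 /\ forall c, h.[c] != 0 ->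
    exists x, [/\ zeros (P i) x, \sum_j a 0 j * x 0 j = c & peval (S i) x != 0].
  by move=> i; have [h h0 hh] := fib i; exists h.
have [h' h'0 hh'] := generic_parameter ga.
have H0 : h' * \prod_i h i != 0.
  by rewrite mulf_neq0 //; apply/prodf_neq0 => i _; have [] := hh i.
have [c] := nonroot H0; rewrite hornerM mulf_eq0 negb_or => /andP[/hh' hc].
rewrite horner_prod => /prodf_neq0 hci.
have /choice[x hx] : forall i, exists x,
    [/\ zeros (P i) x, \sum_j a 0 j * x 0 j = c & peval (S i) x != 0].
  by move=> i; have [_] := hh i; apply; apply: hci.
have injx : injective x.
  move=> i j e; apply/eqP/negPn/negP => ij.
  have [_ _ /eqP] := hx i; apply; have [zj _ _] := hx j.
  by rewrite e; apply/zj/PS.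
have := hsec (generic_neq0 ga) hc (s := [seq x i | i <- enum 'I_k]).
rewrite size_map size_enum_ord; apply; first by rewrite map_inj_uniq ?enum_uniq.
by move=> _ /mapP[i _ ->]; have [/PC Cx e _] := hx i.
Qed.

End Degree.

(** * Prime ideals of germs of arcs *)

Section Lead.
Variables (R : realType).
Local Notation R3 := 'rV[R]_3.
Implicit Types (p : {mpoly R[3]}) (f : R -> R3) (u w : R3).

Lemma cvg_bigsum (T : Type) (F : set_system T) {FF : Filter F} (I : Type) (r : seq I)
    (g : I -> T -> R) (l : I -> R) :
  (forall i, g i t @[t --> F] --> l i) ->
  (\sum_(i <- r) g i t) @[t --> F] --> \sum_(i <- r) l i.
Proof.
move=> h; elim: r => [|i r IH].
  rewrite big_nil (_ : (fun t => _) = (fun=> 0)); first exact: cvg_cst.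
  by apply/funext => t; rewrite big_nil.
rewrite big_cons (_ : (fun t => _) = (fun t => g i t + \sum_(j <- r) g j t)).
  exact: cvgD.
by apply/funext => t; rewrite big_cons.
Qed.

Lemma cvg_peval_iter_dird (T : Type) (F : set_system T) {FF : Filter F}
    (w : T -> R3) u k p x :
  w t @[t --> F] --> u ->
  peval (iter k (dird (w t)) p) x @[t --> F] --> peval (iter k (dird u) p) x.
Proof.
move=> wu; elim: k p => [|k IH] p; first exact: cvg_cst.
have iterE v : peval (iter k.+1 (dird v) p) x =
    \sum_(i < 3) v 0 i * peval (iter k (dird v) (mderiv i p)) x.
  rewrite iterSr {2}/dird; elim/big_rec2: _ => [|i y1 y2 _ <-].
    have := iter_dirdZ k v 0 (0 : {mpoly R[3]}); rewrite !scale0r => ->.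
    by rewrite peval0.
  by rewrite iter_dirdD pevalD iter_dirdZ pevalZ.
rewrite iterE (_ : (fun t => _) =
    (fun t => \sum_(i < 3) w t 0 i * peval (iter k (dird (w t)) (mderiv i p)) x)).
  apply: cvg_bigsum => i; apply: cvgM; last exact: IH.
  apply: (cvg_comp w (fun M : R3 => M 0 i) wu); exact: coord_continuous.
by apply/funext => t; rewrite iterE.
Qed.

(** Taylor expansion at f 0 in the moving direction (f t - f 0) / t, which tends to [u]: the orders
    below a vanish, those above a carry a positive power of t. *)
Lemma cvg_lead f u a p : right_derivative0 f u -> vanishes_to a p (f 0) ->
  t^-1 ^+ a * peval p (f t) @[t --> 0^'+] --> a`!%:R^-1 * peval (iter a (dird u) p) (f 0).
Proof.
move=> fu pa; pose w t := t^-1 *: (f t - f 0).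
(* The cut-off exceeds a so that the order a occurs in the sum even if it is beyond the degree of
   [p]. *)
pose N := maxn (msz p) a.+1.
have aN : (a < N)%N by rewrite leq_maxr.
pose g (k : 'I_N) (t : R) : R := if (k < a)%N then 0 else
  t ^+ (k - a) / k`!%:R * peval (iter k (dird (w t)) p) (f 0).
pose l (k : 'I_N) : R := if (k < a)%N then 0 else
  0 ^+ (k - a) / k`!%:R * peval (iter k (dird u) p) (f 0).
have -> : a`!%:R^-1 * peval (iter a (dird u) p) (f 0) = \sum_k l k.
  rewrite (bigD1 (Ordinal aN)) //= big1 /l ?addr0 => [|k ka] /=.
    by rewrite ltnn subnn expr0 mul1r.
  case: ltnP => // ak; rewrite expr0n subn_eq0 leqNgt ltn_neqAle ak andbT.
  by rewrite (_ : a != k) ?mul0r //; apply: contra ka => /eqP e; apply/eqP/val_inj.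
have : \sum_k g k t @[t --> 0^'+] --> \sum_k l k.
  apply: cvg_bigsum => k; rewrite /g /l; case: ltnP => _; first exact: cvg_cst.
  apply: cvgM; last exact: cvg_peval_iter_dird.
  apply: cvgM; last exact: cvg_cst.
  have t0 : (t : R) @[t --> 0^'+] --> (0 : R) by apply: cvg_within.
  elim: (k - a)%N => [|m IH]; first exact: cvg_cst.
  by rewrite exprS; under eq_fun do rewrite exprS; apply: cvgM.
apply: cvg_trans; apply: near_eq_cvg; near=> t.
have t0 : t != 0 by rewrite gt_eqF //; near: t; exact: nbhs_right_gt.
have ft : f t = f 0 + t *: w t by rewrite /w scalerA divff // scale1r addrC subrK.
rewrite ft (@mpoly_taylor _ _ N) ?leq_maxl // mulr_sumr; apply: eq_bigr => k _.
rewrite /g; case: ltnP => [ka|ak].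
  by rewrite (vanishes_to_peval_iter _ pa ka) !mulr0.
have e : t^-1 ^+ a * t ^+ k = t ^+ (k - a).
  by rewrite exprVn -[in t ^+ k](subnK ak) exprD mulrCA mulVf ?mulr1 ?expf_neq0.
by rewrite !mulrA e.
Unshelve. all: by end_near. Qed.

End Lead.

Section GermIdeal.
Variables (R : realType) (U : set_system R).
Context {UU : UltraFilter U}.

(** Vanishing for all small s need not define a prime ideal for an arbitrary arc; vanishing on a set
    of the ultrafilter does. *)
Definition germ_ideal n (K : fieldType) (F : R -> 'rV[K]_n) : set {mpoly K[n]} :=
  [set g | U [set s | peval g (F s) = 0]].

Lemma germ_ideal_prime n (K : fieldType) (F : R -> 'rV[K]_n) : prime_ideal (germ_ideal F).
Proof.
split; rewrite /germ_ideal /=.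
- by apply: filterS filterT => s _; rewrite /= peval0.
- move=> x y Ux Uy; apply: filterS (filterI Ux Uy) => s [/= hx hy].
  by rewrite pevalD hx hy addr0.
- by move=> x y; apply: filterS => s /= hy; rewrite pevalM hy mulr0.
- move=> x y Uxy.
  have [|nx] := in_ultra_setVsetC [set s | peval x (F s) = 0] UU; [by left|right].
  apply: filterS (filterI Uxy nx) => s [/= /eqP]; rewrite pevalM mulf_eq0.
  by case/orP => /eqP.
- move=> U1; have [s] := filter_ex U1; rewrite /= peval1 => /eqP.
  by rewrite oner_eq0.
Qed.

End GermIdeal.

Lemma peval_map_mpoly n (K L : fieldType) (phi : {rmorphism K -> L})
    (g : {mpoly K[n]}) (x : 'rV[K]_n) :
  peval (map_mpoly phi g) (map_mx phi x) = phi (peval g x).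
Proof.
elim/mpoly_ring_ind: g => [c|i|p q|p q].
- by rewrite map_mpolyC !pevalC.
- by rewrite map_mpolyX !pevalX mxE.
- by move=> hp hq; rewrite [map_mpoly _ _]raddfD /= !pevalD hp hq -rmorphD.
- by move=> hp hq; rewrite [map_mpoly _ _]rmorphM /= !pevalM hp hq -rmorphM.
Qed.

Section ComplexParts.
Variable R : realType.

Definition cpart (b : bool) (z : R[i]) : R := if b then complex.Im z else complex.Re z.

Lemma cpart0 b : cpart b 0 = 0. Proof. by case: b. Qed.

Lemma cpartD b : {morph cpart b : x y / x + y}.
Proof. by case: b => -[? ?] [? ?]. Qed.

Lemma cpartB b : {morph cpart b : x y / x - y}.
Proof. by case: b => -[? ?] [? ?]. Qed.

Lemma cpartM b z r : cpart b (z * real_complex R r) = cpart b z * r.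
Proof. by case: b; case: z => x y /=; rewrite mulr0 ?add0r ?subr0 ?addr0. Qed.

Lemma cpart_sum b (I : Type) (r : seq I) (F : I -> R[i]) :
  cpart b (\sum_(i <- r) F i) = \sum_(i <- r) cpart b (F i).
Proof. exact: (big_morph _ (cpartD b) (cpart0 b)). Qed.

Lemma cpart_eq0 z : (forall b, cpart b z = 0) -> z = 0.
Proof. by case: z => x y h; have := h true; have := h false; rewrite /= => -> ->. Qed.

Lemma peval_complexify n (g : {mpoly R[n]}) (x : 'rV[R]_n) :
  peval (map_mpoly (real_complex R) g) (complexify x) = real_complex R (peval g x).
Proof. exact: (peval_map_mpoly (real_complex R : {rmorphism _ -> _})). Qed.

Lemma deg_le_map n m (g : {mpoly R[n]}) : deg_le m g -> deg_le m (map_mpoly (real_complex R) g).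
Proof.
rewrite /deg_le => gm; rewrite msizeE; apply/bigmax_leqP_seq => k kg _.
apply: leq_trans gm; apply: msize_mdeg_lt; move: kg.
by rewrite !mcoeff_msupp mcoeff_map_mpoly; apply: contraNneq => ->; apply/eqP.
Qed.

Lemma complexify_eq0 n (x : 'rV[R]_n) : (complexify x == 0) = (x == 0).
Proof.
apply/eqP/eqP => [/rowP h|->]; apply/rowP => i; last by rewrite !mxE.
by have := h i; rewrite !mxE => -[].
Qed.

End ComplexParts.

Lemma dird_linform (n : nat) (K : fieldType) (b u : 'rV[K]_n) c :
  dird u (linform b - mpolyC n c) = mpolyC n (\sum_i b 0 i * u 0 i).
Proof.
rewrite /dird raddf_sum; apply: eq_bigr => i _ /=.
rewrite mderivB mderivC subr0 /linform (raddf_sum (mderiv i)) /= (bigD1 i) //= big1 ?addr0.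
  rewrite mderivZ mderivX mnm1E eqxx scale1r (_ : mnm_sub _ _ = mnm0); last first.
    by apply/mnmP => k; rewrite mnmBE subnn mnm0E.
  by rewrite mpolyX0 scalerA -mul_mpolyC mulr1 mulrC.
by move=> j ji; rewrite mderivZ mderivX mnm1E (negbTE ji) scale0r scaler0.
Qed.

Section Germs.
Variables (R : realType) (U : set_system R).
Context {UU : UltraFilter U}.
Hypothesis U0 : 0^'+ `<=` U.
Local Notation R3 := 'rV[R]_3.
Implicit Types (f : R -> R3) (u : R3).

Definition real_germ f : set {mpoly R[3]} := germ_ideal U f.
Definition complex_germ f : set {mpoly R[i][3]} :=
  germ_ideal U (@complexify R 3 \o f).

Lemma germ_limit_eq0 (g : R -> R) l :
  g t @[t --> 0^'+] --> l -> U [set t | g t = 0] -> l = 0.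
Proof.
move=> gl Ug.
have Ul : g t @[t --> U] --> l by move=> A /gl; apply: U0.
apply: (cvg_unique _ Ul) => //.
apply: cvg_near_cst; apply: filterS Ug => t /= ->; done.
Qed.

Lemma germ_dird_eq0 f u a p : right_derivative0 f u -> vanishes_to a p (f 0) ->
  real_germ f p -> peval (iter a (dird u) p) (f 0) = 0.
Proof.
move=> fu pa Up; have /germ_limit_eq0 := cvg_lead fu pa.
have /[swap] /[apply] /eqP : U [set t | t^-1 ^+ a * peval p (f t) = 0].
  by apply: filterS Up => t /= ->; rewrite mulr0.
by rewrite mulf_eq0 invr_eq0 pnatr_eq0 eqn0Ngt fact_gt0 => /eqP.
Qed.

(** The real and imaginary parts of the form would lie in the real germ ideal, and by
    [germ_dird_eq0] their derivatives along [u], the two parts of a . u, would vanish. *)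
Lemma complex_germ_nconst f u (a : 'rV[R[i]]_3) c : right_derivative0 f u ->
  \sum_i a 0 i * complexify u 0 i != 0 -> ~ complex_germ f (linform a - mpolyC 3 c).
Proof.
move=> fu au Ua; case/eqP: au; apply: cpart_eq0 => b.
pose p := linform (\row_i cpart b (a 0 i)) - mpolyC 3 (cpart b c).
have Up : real_germ f p.
  apply: filterS Ua => s /= /(congr1 (cpart b)); rewrite cpart0 => <-.
  rewrite !pevalB !pevalC cpartB !peval_linform cpart_sum; congr (_ - _).
  by apply: eq_bigr => i _; rewrite !mxE cpartM.
have p0 : peval p (f 0) = 0 by exact: (@germ_dird_eq0 f u 0).
have := @germ_dird_eq0 f u 1 p fu (conj p0 (fun=> I)) Up.
rewrite /= dird_linform pevalC => h; rewrite -[RHS]h cpart_sum.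
by apply: eq_bigr => i _; rewrite !mxE cpartM.
Qed.

Lemma complex_germ_map f g :
  complex_germ f (map_mpoly (real_complex R) g) <-> real_germ f g.
Proof.
rewrite /complex_germ /real_germ /germ_ideal /=; split; apply: filterS => s /=;
  rewrite peval_complexify; last by move=> ->; rewrite rmorph0.
by case.
Qed.

Lemma real_germ_eq f f' : complex_germ f = complex_germ f' -> real_germ f = real_germ f'.
Proof.
by move=> e; apply/seteqP; split=> g; rewrite -!complex_germ_map e.
Qed.

(** A complex relation between real polynomials splits into two real ones, and one of them has a
    nonzero coefficient. *)
Lemma real_germ_growth f S : growth (complex_germ f) S -> growth (real_germ f) S.
Proof.
move=> [C hC]; exists C => m M w NM dw.
have [|v [[i0 vi0] Pv]] := hC m M (fun i => map_mpoly (real_complex R) (w i)) NM.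
  by move=> i; apply: deg_le_map; apply: dw.
have [b vb] : exists b, cpart b (v i0) != 0.
  apply: contrapT => no; case/eqP: vi0; apply: cpart_eq0 => b.
  by apply: contrapT => /eqP h; apply: no; exists b.
exists (fun i => cpart b (v i)); split; first by exists i0.
apply: filterS Pv => s /= /(congr1 (cpart b)); rewrite cpart0 => <-.
rewrite !peval_sum cpart_sum; apply: eq_bigr => i _.
by rewrite !pevalZ peval_complexify cpartM.
Qed.

Lemma complex_germ_zeros f (gamma : set R3) (C : set 'rV[R[i]]_3) :
  algebraic_set C -> (@complexify R 3) @` gamma `<=` C ->
  (forall s, 0 <= s < 1 -> gamma (f s)) -> zeros (complex_germ f) `<=` C.
Proof.
move=> [ps ->] sub fg x zx p pps; apply: zx.
have : 0^'+ [set s : R | 0 <= s < 1].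
  near=> s; apply/andP; split; first by apply: ltW; near: s; exact: nbhs_right_gt.
  by near: s; apply: nbhs_right_lt.
move=> /U0; apply: filterS => s /fg gs; apply: (sub (complexify (f s))) => //.
Unshelve. all: by end_near. Qed.

End Germs.

(** Each point has multiplicity at least 1: the constant 1 is nonzero in the local ring, since the
    whole section ideal vanishes at the point. *)
Lemma section_bound_of_degree (K : closedFieldType) (C : set 'rV[K]_3) d :
  complex_degree C d -> exists2 Q, Q != 0 & section_bound C Q d.
Proof.
move=> [Q Q0 h]; exists Q => // a c a0 Qac s us hs.
have [pts [m [upts epts hm <-]]] := h a c a0 Qac.
have sub : {subset s <= pts}.
  move=> x /hs[Cx ax]; suff : [set` pts] x by [].
  rewrite epts; split=> //; rewrite /hyperplane /= hyperplane_polyE pevalB pevalC.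
  by rewrite peval_linform ax subrr.
apply: leq_trans (uniq_leq_size us sub) _.
rewrite -sum1_size big_seq [X in (_ <= X)%N]big_seq; apply: leq_sum => x xp.
have [_ mmax] := hm _ xp; apply: (mmax 1%N (fun=> 1)) => coef s0 s0x [g [q [Cg e]]] i.
have Cx : C x by have : [set` pts] x by []; rewrite epts => -[].
have hx : peval (hyperplane_poly a c) x = 0.
  by have : [set` pts] x by []; rewrite epts => -[].
have := congr1 (fun z => peval z x) e; rewrite big_ord1 pevalM pevalZ peval1 mulr1.
rewrite pevalD pevalM hx mulr0 addr0 Cg // => /eqP.
by rewrite mulf_eq0 (negbTE s0x) /= (ord1 i) => /eqP.
Qed.

(** * Bezout along a component *)

Section LeadCalculus.
Variables (R : realType) (f : R -> 'rV[R]_3).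
Implicit Types g h : {mpoly R[3]}.

Definition lead_along a g (l : R) := t^-1 ^+ a * peval g (f t) @[t --> 0^'+] --> l.

Lemma lead_alongM a b g h l m :
  lead_along a g l -> lead_along b h m -> lead_along (a + b) (g * h) (l * m).
Proof.
move=> ga hb; rewrite /lead_along (_ : (fun t => _) =
  (fun t => (t^-1 ^+ a * peval g (f t)) * (t^-1 ^+ b * peval h (f t)))).
  exact: cvgM.
by apply/funext => t; rewrite pevalM exprD; ring.
Qed.

Lemma lead_alongX a g l k : lead_along a g l -> lead_along (k * a) (g ^+ k) (l ^+ k).
Proof.
move=> ga; elim: k => [|k IH].
  rewrite /lead_along (_ : (fun t => _) = (fun=> 1)); first exact: cvg_cst.
  by apply/funext => t; rewrite !expr0 peval1 mulr1.
by rewrite !exprS mulSn; apply: lead_alongM.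
Qed.

Lemma lead_alongZ a c g l : lead_along a g l -> lead_along a (c *: g) (c * l).
Proof.
move=> ga; rewrite /lead_along (_ : (fun t => _) = (fun t => c * (t^-1 ^+ a * peval g (f t)))).
  by apply: cvgM => //; apply: cvg_cst.
by apply/funext => t; rewrite pevalZ mulrCA.
Qed.

Lemma lead_alongD a g h l m :
  lead_along a g l -> lead_along a h m -> lead_along a (g + h) (l + m).
Proof.
move=> ga ha; rewrite /lead_along (_ : (fun t => _) =
  (fun t => t^-1 ^+ a * peval g (f t) + t^-1 ^+ a * peval h (f t))).
  exact: cvgD.
by apply/funext => t; rewrite pevalD mulrDr.
Qed.

Lemma lead_along0 a : lead_along a 0 0.
Proof.
rewrite /lead_along (_ : (fun t => _) = (fun=> 0)); first exact: cvg_cst.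
by apply/funext => t; rewrite peval0 mulr0.
Qed.

Lemma lead_along_sum a (I : Type) (r : seq I) (Q : pred I) (F : I -> {mpoly R[3]}) :
  (forall i, Q i -> lead_along a (F i) 0) -> lead_along a (\sum_(i <- r | Q i) F i) 0.
Proof.
move=> h; elim/big_ind: _ => //; first exact: lead_along0.
by move=> x y hx hy; rewrite -[0]addr0; apply: lead_alongD.
Qed.

Lemma lead_along_lt a b g l : (b < a)%N -> lead_along a g l -> lead_along b g 0.
Proof.
move=> ba ga; rewrite /lead_along -[X in _ --> X](mul0r l).
have t0 : (t : R) @[t --> 0^'+] --> (0 : R) by apply: cvg_within.
have tk k : (t : R) ^+ k.+1 @[t --> 0^'+] --> (0 : R).
  elim: k => [|k IH]; first exact: t0.
  rewrite (_ : (fun t => _) = (fun t : R => t * t ^+ k.+1)).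
    by have := cvgM t0 IH; rewrite mulr0; apply.
  by apply/funext => t; rewrite exprS.
have : t ^+ (a - b).-1.+1 * (t^-1 ^+ a * peval g (f t)) @[t --> 0^'+] --> 0 * l.
  exact: cvgM (tk (a - b).-1) ga.
apply: cvg_trans; apply: near_eq_cvg; near=> t.
have tn0 : t != 0 by rewrite gt_eqF //; near: t; exact: nbhs_right_gt.
rewrite /= prednK ?subn_gt0 // mulrA; congr (_ * _).
rewrite !exprVn -[in t ^- a](subnK (ltnW ba)) exprD invfM mulrA divff ?mul1r //.
by rewrite expf_neq0.
Unshelve. all: by end_near. Qed.

Variables (u : 'rV[R]_3).
Hypothesis fu : right_derivative0 f u.

Lemma lead_along_vanishing a g : vanishes_to a g (f 0) -> exists l, lead_along a g l.
Proof. by move=> ga; eexists; apply: cvg_lead fu ga. Qed.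

Lemma lead_along_peval g : lead_along 0 g (peval g (f 0)).
Proof.
by have := @cvg_lead _ f u 0 g fu I; rewrite fact0 invr1 mul1r.
Qed.

Lemma lead_along_coord k : lead_along 1 (mX k - mpolyC 3 (f 0 0 k)) (u 0 k).
Proof.
have e : mX k = linform (delta_mx 0 k : 'rV[R]_3).
  rewrite /linform (bigD1 k) //= big1 ?addr0 => [|i ik]; rewrite mxE /=.
    by rewrite eqxx scale1r.
  by rewrite (negbTE ik) scale0r.
have v1 : vanishes_to 1 (mX k - mpolyC 3 (f 0 0 k)) (f 0).
  by split=> //; rewrite pevalB pevalX pevalC subrr.
have := cvg_lead fu v1; rewrite /= factS fact0 muln1 invr1 mul1r e dird_linform pevalC.
rewrite (bigD1 k) //= big1 ?addr0 => [|i ik]; rewrite mxE /=.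
  by rewrite eqxx mul1r.
by rewrite (negbTE ik) mul0r.
Qed.

End LeadCalculus.

Section Bezout.
Variables (R : realType) (U : set_system R).
Context {UU : UltraFilter U}.
Hypothesis U0 : 0^'+ `<=` U.
Variables (P : set {mpoly R[3]}) (S N : nat).
Variables (f : 'I_N -> R -> 'rV[R]_3) (u : 'I_N -> 'rV[R]_3).
Hypotheses (Pprime : prime_ideal P) (Pgrowth : growth P S).
Hypotheses (fu : forall i, right_derivative0 (f i) (u i)) (u0 : forall i, u i != 0).
Hypotheses (Pf : forall i, P = real_germ U (f i)) (finj : injective (fun i => f i 0)).

Arguments fu : clear implicits.

Lemma growth_fin : exists C, forall m (I : finType) (w : I -> {mpoly R[3]}),
  (S * (m + C) < #|I|)%N -> (forall i, deg_le m (w i)) ->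
  exists v : I -> R, (exists i, v i != 0) /\ P (\sum_i v i *: w i).
Proof.
have [C hC] := Pgrowth; exists C => m I w mI dw.
have [|v [[i0 vi0] Pv]] := hC m #|I| (w \o enum_val) mI; first by move=> i; apply: dw.
exists (v \o enum_rank); split; first by exists (enum_val i0); rewrite /= enum_valK.
move: Pv; congr P; rewrite (reindex enum_rank) /=; last exact/onW_bij/enum_rank_bij.
by apply: eq_bigr => i _; rewrite enum_rankK.
Qed.

Lemma row_neq0 (v : 'rV[R]_3) : v != 0 -> exists k, v 0 k != 0.
Proof.
move=> v0; apply: contrapT => no; case/eqP: v0; apply/rowP => k; rewrite mxE.
by apply: contrapT => /eqP h; apply: no; exists k.
Qed.

(* G i j has order exactly j along f i and order at least a along *)
(* the other germs. *)
Lemma separators a : exists G : 'I_N -> nat -> {mpoly R[3]},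
  (forall i j, exists2 l, l != 0 & lead_along (f i) j (G i j) l) /\
  (forall i i' j, i != i' -> exists l, lead_along (f i) a (G i' j) l).
Proof.
have /choice[k hk] : forall i, exists k, u i 0 k != 0 by move=> i; apply: row_neq0.
have hk' i i' : exists k, i != i' -> f i 0 0 k != f i' 0 0 k.
  have [->|ii'] := eqVneq i i'; first by exists 0.
  have [|k0] := @row_neq0 (f i 0 - f i' 0).
    by rewrite subr_eq0; apply: contra ii' => /eqP/finj->.
  by rewrite !mxE subr_eq0 => h; exists k0.
pose k' i i' := projT1 (cid (hk' i i')).
have k'P i i' : i != i' -> f i 0 0 (k' i i') != f i' 0 0 (k' i i').
  exact: (projT2 (cid (hk' i i'))).
(* [s i] is nonzero at the i-th base point and vanishes to order at least a at the others. *)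
pose s i : {mpoly R[3]} :=
  \prod_(i' | i' != i) (mX (k' i i') - mpolyC 3 (f i' 0 0 (k' i i'))) ^+ a.
exists (fun i j => (mX (k i) - mpolyC 3 (f i 0 0 (k i))) ^+ j * s i); split=> [i j|i i' j ii'].
  exists (u i 0 (k i) ^+ j * peval (s i) (f i 0)).
    rewrite mulf_neq0 ?expf_neq0 // /s peval_prod; apply/prodf_neq0 => i' i'i.
    rewrite pevalXn expf_neq0 // pevalB pevalX pevalC subr_eq0.
    by apply: k'P; rewrite eq_sym.
  have ec := @lead_along_coord _ _ _ (fu i) (k i).
  have es := @lead_along_peval _ _ _ (fu i) (s i).
  by have := lead_alongM (@lead_alongX _ _ _ _ _ j ec) es; rewrite muln1 addn0.
have e1 := @lead_along_peval _ _ _ (fu i) ((mX (k i') - mpolyC 3 (f i' 0 0 (k i'))) ^+ j).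
have ec := @lead_along_coord _ _ _ (fu i) (k' i' i).
have es := @lead_along_peval _ _ _ (fu i) (\prod_(i'' | (i'' != i') && (i'' != i))
  (mX (k' i' i'') - mpolyC 3 (f i'' 0 0 (k' i' i''))) ^+ a).
have := lead_alongM e1 (lead_alongM (@lead_alongX _ _ _ _ _ a ec) es).
rewrite add0n addn0 muln1 => h; eexists; rewrite /s (bigD1 i) //; exact: h.
Qed.

Variables (Q : {mpoly R[3]}) (n a : nat).
Hypotheses (nQ : ~ P Q) (dQ : deg_le n Q) (Qa : forall i, vanishes_to a Q (f i 0)).

Arguments Qa : clear implicits.

(* The products of separators with powers of Q are independent modulo P, so   *)
(* their number a * N * k is at most S * (n * k + O(1)) for all k. *)
Lemma bezout : (a * N <= S * n)%N.
Proof.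
rewrite leqNgt; apply/negP => SnaN.
have [G [Gi Gii']] := separators a.
have indep0 (v : 'I_N -> 'I_a -> R) H :
    P (\sum_i \sum_j v i j *: G i j + Q * H) -> forall i j, v i j = 0.
  move=> Pw i j0; apply/eqP/negPn/negP => vij0.
  (* Along f i the sum has order exactly this least j: later G i j', the separators of the other
     germs and multiples of Q all have larger order. *)
  have [j vij jmin] := @arg_minnP _ j0 (fun j => v i j != 0) val vij0.
  have [l l0 Gl] := Gi i j.
  suff /(germ_limit_eq0 U0) : lead_along (f i) j (\sum_i \sum_j v i j *: G i j + Q * H) (v i j * l).
    have Uw : U [set t | t^-1 ^+ j * peval (\sum_i \sum_j v i j *: G i j + Q * H) (f i t) = 0].
      by move: Pw; rewrite (Pf i); apply: filterS => t /= ->; rewrite mulr0.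
    by move=> /(_ Uw)/eqP; rewrite mulf_eq0 (negbTE vij) (negbTE l0).
  rewrite -[v i j * l]addr0; apply: lead_alongD; last first.
    have [m Qm] := lead_along_vanishing (fu i) (Qa i).
    apply: (@lead_along_lt _ _ (a + 0) j _ (m * peval H (f i 0))); first by rewrite addn0.
    by apply: lead_alongM => //; exact: (@lead_along_peval _ _ _ (fu i)).
  rewrite (bigD1 i) //= -[v i j * l]addr0; apply: lead_alongD; last first.
    apply: lead_along_sum => i' i'i; apply: lead_along_sum => j' _.
    have [|m Gm] := Gii' i i' j'; first by rewrite eq_sym.
    by rewrite -(mulr0 (v i' j')); apply: lead_alongZ; apply: lead_along_lt Gm.
  rewrite (bigD1 j) //= -[v i j * l]addr0; apply: lead_alongD; first exact: lead_alongZ.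
  apply: lead_along_sum => j' j'j.
  have [->|vij'] := eqVneq (v i j') 0; first by rewrite scale0r; apply: lead_along0.
  have jj' : (j < j')%N by rewrite ltn_neqAle jmin // andbT eq_sym.
  have [m _ Gm] := Gi i j'.
  by rewrite -(mulr0 (v i j')); apply: lead_alongZ; apply: lead_along_lt Gm.
(* The terms with e = 0 are killed by [indep0]; then a factor Q is cancelled, since P is prime and
   does not contain Q. *)
have indep k (v : nat -> 'I_N -> 'I_a -> R) :
    P (\sum_(e < k) Q ^+ e * \sum_i \sum_j v e i j *: G i j) ->
    forall e i j, (e < k)%N -> v e i j = 0.
  elim: k v => [|k IH] v; first by move=> _ e i j.
  rewrite big_ord_recl expr0 mul1r.
  have -> : \sum_(e < k) Q ^+ lift ord0 e * (\sum_i \sum_j v (lift ord0 e) i j *: G i j) =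
      Q * \sum_(e < k) Q ^+ e * (\sum_i \sum_j v e.+1 i j *: G i j).
    by rewrite mulr_sumr; apply: eq_bigr => e _; rewrite exprS mulrA.
  move=> Pw; have v0 := indep0 _ _ Pw.
  have {}Pw : P (Q * \sum_(e < k) Q ^+ e * (\sum_i \sum_j v e.+1 i j *: G i j)).
    move: Pw; rewrite big1 ?add0r // => i _; rewrite big1 // => j _.
    by rewrite [v _ _ _]v0 scale0r.
  have [//|/(IH (fun e => v e.+1)) h] := prime_idealP Pprime Pw.
  by move=> [|e] i j; [move=> _; apply: v0 | rewrite ltnS; apply: h].
have [C hC] := growth_fin.
pose dG := \max_(x : 'I_N * 'I_a) msz (G x.1 x.2).
have dGP i (j : 'I_a) : deg_le dG (G i j).
  by rewrite /deg_le leqW // (leq_bigmax (F := fun x : 'I_N * 'I_a => msz (G x.1 x.2)) (i, j)).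
(* Under the assumption S * n < a * N, the surplus of a * N * k over S * n * k is at least k, and so
   exceeds the constant S * (dG + C). *)
pose k := (S * (dG + C)).+1.
pose w (x : 'I_k * ('I_N * 'I_a)) := Q ^+ x.1 * G x.2.1 x.2.2.
have [||v [[[e [i j]] ve] Pv]] := hC (k * n + dG)%N _ w.
- rewrite !card_prod !card_ord.
  have -> : (S * (k * n + dG + C) = S * n * k + S * (dG + C))%N by ring.
  have -> : (k * (N * a) = a * N * k)%N by ring.
  have h : ((S * n).+1 * k <= a * N * k)%N by rewrite leq_mul2r SnaN orbT.
  by apply: leq_trans h; rewrite mulSn addnC ltn_add2r.
- move=> [e [i j]]; apply: deg_leM => //=; apply: deg_leW (deg_leX e dQ).
  by rewrite leq_mul2r ltnW ?orbT.
case/eqP: ve; pose v' e i j := v (inord e, (i, j)).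
have -> : v (e, (i, j)) = v' e i j by rewrite /v' inord_val.
apply: (indep k v') => //; move: Pv; congr P.
rewrite (eq_bigr (fun x => v (x.1, x.2) *: w (x.1, x.2))); last by case.
rewrite -(pair_bigA _ (fun x y => v (x, y) *: w (x, y))) /=; apply: eq_bigr => x _.
rewrite (eq_bigr (fun y => v (x, (y.1, y.2)) *: w (x, (y.1, y.2)))); last by move=> [].
rewrite -(pair_bigA _ (fun y z => v (x, (y, z)) *: w (x, (y, z)))) /= mulr_sumr.
apply: eq_bigr => y _; rewrite mulr_sumr; apply: eq_bigr => z _.
by rewrite /v' inord_val /w /= scalerAr.
Qed.

End Bezout.

(** * Counting joints *)

Lemma kernel_exists (F : fieldType) (I J : finType) (A : I -> J -> F) : (#|J| < #|I|)%N ->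
  exists c : I -> F, (exists i, c i != 0) /\ forall j, \sum_i c i * A i j = 0.
Proof.
move=> JI; pose M : 'M[F]_(#|I|, #|J|) := \matrix_(i, j) A (enum_val i) (enum_val j).
have kn0 : kermx M != 0.
  rewrite -mxrank_eq0 mxrank_ker -lt0n subn_gt0.
  exact: leq_ltn_trans (rank_leq_col _) JI.
have /rowV0Pn[v vk v0] := kn0.
exists (fun i => v 0 (enum_rank i)); split.
  apply: contrapT => no; case/eqP: v0; apply/rowP => i; rewrite mxE.
  by apply: contrapT => /eqP vi; apply: no; exists (enum_val i); rewrite enum_valK.
move=> j; have /sub_kermxP/matrixP/(_ 0 (enum_rank j)) := vk; rewrite mxE mxE => e; rewrite -[RHS]e.
rewrite [RHS](reindex enum_rank) /=; last exact/onW_bij/enum_rank_bij.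
by apply: eq_bigr => i _; rewrite mxE !enum_rankK.
Qed.

Lemma iter_dird_swap n (K : fieldType) (v w : 'rV[K]_n) a b p :
  iter a (dird v) (iter b (dird w) p) = iter b (dird w) (iter a (dird v) p).
Proof. by elim: b => // b IH; rewrite !iterS iter_dird_comm IH. Qed.

Section Key.
Variables (R : realType) (U : set_system R).
Context {UU : UltraFilter U}.
Hypothesis U0 : 0^'+ `<=` U.
Variables (I : finType) (pt : I -> 'rV[R]_3) (S : nat).
Variables (f : 'I_3 -> I -> R -> 'rV[R]_3) (u : 'I_3 -> I -> 'rV[R]_3).
Hypotheses (ptinj : injective pt) (S0 : (0 < S)%N) (f0 : forall i p, f i p 0 = pt p).
Hypotheses (fu : forall i p, right_derivative0 (f i p) (u i p)).
Hypotheses (u0 : forall i p, u i p != 0).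
Hypothesis ubasis : forall p k, exists c : 'I_3 -> R, delta_mx 0 k = \sum_j c j *: u j p.
Hypothesis fgrowth : forall i p, growth (real_germ U (f i p)) S.
Arguments fu : clear implicits.
Arguments ubasis : clear implicits.

Variables (J : {set I}) (N : 'I_3 -> nat).
Hypotheses (J0 : J != finset.set0) (N0 : forall i, (0 < N i)%N).
Hypothesis rich : forall i p, p \in J ->
  (N i <= #|[set q in J | `[< real_germ U (f i q) = real_germ U (f i p) >]]%SET|)%N.

Let dd (p : I) (a : 'I_3 -> nat) Q :=
  iter (a 0) (dird (u 0 p)) (iter (a 1) (dird (u 1 p)) (iter (a 2%:R) (dird (u 2%:R p)) Q)).

Lemma dd_sum p a (E : finType) (c : E -> R) (F : E -> {mpoly R[3]}) :
  dd p a (\sum_e c e *: F e) = \sum_e c e *: dd p a (F e).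
Proof.
have ds b w (G : E -> {mpoly R[3]}) :
    iter b (dird w) (\sum_e c e *: G e) = \sum_e c e *: iter b (dird w) (G e).
  elim: b => // b IH; rewrite iterS IH dird_sum; apply: eq_bigr => e _.
  by rewrite dirdZ.
by rewrite /dd !ds.
Qed.

(** Directional derivatives commute, so those in the other two directions can be taken first; this
    gives Q'. *)
Lemma dd_isolate p a Q i : exists Q' : {mpoly R[3]},
  [/\ dd p a Q = iter (a i) (dird (u i p)) Q', (msz Q' <= msz Q)%N &
    forall x, vanishes_to (a 0%R + a 1%R + a 2%:R%R) Q x -> vanishes_to (a i) Q' x].
Proof.
have ms b w (P : {mpoly R[3]}) : (msz (iter b (dird w) P) <= msz P)%N.
  exact: leq_trans (msz_iter_dird _ _ _) (leq_subr _ _).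
have vi b c w (P : {mpoly R[3]}) x : vanishes_to (b + c) P x ->
  vanishes_to b (iter c (dird w) P) x by apply: vanishes_to_iter_dird.
have [->|i0] := eqVneq i 0.
  exists (iter (a 1) (dird (u 1 p)) (iter (a 2%:R) (dird (u 2%:R p)) Q)); split=> //.
    exact: leq_trans (ms _ _ _) (ms _ _ _).
  by move=> x h; do 2! apply: (vi).
have [->|i1] := eqVneq i 1.
  exists (iter (a 0) (dird (u 0 p)) (iter (a 2%:R) (dird (u 2%:R p)) Q)); split=> [||x h].
  - by rewrite /dd iter_dird_swap.
  - exact: leq_trans (ms _ _ _) (ms _ _ _).
  - by do 2! apply: (vi); rewrite (addnC (a 1)).
have -> : i = 2%:R by case: i i0 i1 => -[|[|[|]]] // h _ _; apply/val_inj.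
exists (iter (a 0) (dird (u 0 p)) (iter (a 1) (dird (u 1 p)) Q)); split=> [||x h].
- by rewrite /dd (iter_dird_swap _ _ (a 1)) iter_dird_swap.
- exact: leq_trans (ms _ _ _) (ms _ _ _).
- by do 2! apply: (vi); rewrite -addnA addnC.
Qed.

(* At a point p of J where Q vanishes to the least order, some mixed derivative *)
(* of Q at p of that order is nonzero; it lies outside the box in a direction i, *)
(* and integrating that direction out contradicts bezout along f i p. *)
Lemma box_vanishing (b : 'I_3 -> nat) n Q : deg_le n Q ->
  (forall i, (S * n < b i * N i)%N) ->
  (forall p a, p \in J -> (forall i, (a i < b i)%N) -> peval (dd p a Q) (pt p) = 0) ->
  Q = 0.
Proof.
move=> dQ hb box; apply/eqP/negPn/negP => Q0.
(* The minimal [v] is the least order of vanishing of Q over J. *)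
pose bad v := `[< exists2 p, p \in J & ~ vanishes_to v.+1 Q (pt p) >].
have [v0 hv0] : exists v, bad v.
  have /finset.set0Pn[p pJ] := J0; apply: contrapT => no; case/eqP: Q0.
  apply: (@vanishes_to_all _ _ _ (pt p)) => k; apply: contrapT => nk; apply: no.
  exists k; apply/asboolP; exists p => // h; apply: nk.
  exact: vanishes_to_leq h.
have [v /asboolP[p pJ np] vmin] := ex_minnP (ex_intro _ v0 hv0).
have vJ q : q \in J -> vanishes_to v Q (pt q).
  move=> qJ; case: v {np} vmin => // v vmin; apply: contrapT => nq.
  have : bad v by apply/asboolP; exists q.
  by move=> /vmin; rewrite ltnn.
have [a [av ne]] := exact_order (ubasis p) (vJ _ pJ) np.
have [i bi] : exists i, (b i <= a i)%N.
  apply: contrapT => no; case/eqP: ne; apply: box => // i.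
  by rewrite ltnNge; apply/negP => bi; apply: no; exists i.
have [Q' [eQ' sQ' vQ']] := dd_isolate p a Q i.
have nQ' : ~ real_germ U (f i p) Q'.
  have vp : vanishes_to (a i) Q' (f i p 0) by rewrite f0; apply: vQ'; rewrite av; apply: vJ.
  move=> /(germ_dird_eq0 U0 (fu i p) vp); rewrite f0 -eQ'.
  by move/eqP: ne.
pose A := [set q in J | `[< real_germ U (f i q) = real_germ U (f i p) >]]%SET.
have AP (k : 'I_#|A|) : enum_val k \in J /\ real_germ U (f i (enum_val k)) = real_germ U (f i p).
  by have := enum_valP k; rewrite finset.inE => /andP[? /asboolP].
suff : (a i * #|A| <= S * n)%N.
  rewrite leqNgt => /negP; apply; apply: leq_trans (hb i) _.
  by apply: leq_mul => //; apply: rich.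
apply: (@bezout R U UU U0 (real_germ U (f i p)) S #|A| (fun k => f i (enum_val k))
  (fun k => u i (enum_val k)) _ _ _ _ _ _ Q') => //.
- exact: germ_ideal_prime.
- by move=> k; rewrite (AP k).2.
- by move=> k l; rewrite !f0 => /ptinj/enum_val_inj.
- exact: leq_trans sQ' dQ.
- by move=> k; rewrite f0; apply: vQ'; rewrite av; apply/vJ/(AP k).1.
Qed.

(** Put M = N_0 N_1 N_2. Polynomials with all exponents below M have M^3 coefficients, and boxes
    with sides b_i = 3 S M / N_i impose 27 S^3 M^2 |J| conditions. If these are fewer, a nonzero
    solution of degree at most 3 (M - 1) exists, and [box_vanishing] applies because 3 S (M - 1) <
    b_i N_i. *)
Lemma key_count : (N 0%R * N 1%R * N 2%:R%R <= 27 * S ^ 3 * #|J|)%N.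
Proof.
set M := (N 0%R * N 1%R * N 2%:R%R)%N; rewrite leqNgt; apply/negP => JM.
have M0 : (0 < M)%N by rewrite /M !muln_gt0 !N0.
pose b (i : 'I_3) := (3 * S * (if i == 0%R then N 1%R * N 2%:R%R else
   if i == 1%R then N 0%R * N 2%:R%R else N 0%R * N 1%R))%N.
have bN i : (b i * N i = 3 * S * M)%N.
  have : [\/ i = 0, i = 1 | i = 2%:R].
    by case: i => -[|[|[|//]]] h; [constructor 1|constructor 2|constructor 3]; apply/val_inj.
  by rewrite /b /M => -[->|->|->] /=; ring.
pose E : finType := {ffun 'I_3 -> 'I_M}.
pose mono (e : E) : {mpoly R[3]} := mpolyX R (Multinom [tuple (e i : nat) | i < 3]).
pose F : finType := (({p : I | p \in J} * 'I_(b 0)) * ('I_(b 1) * 'I_(b 2%:R)))%type.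
pose ix (x : F) (i : 'I_3) : nat := if i == 0 then x.1.2 : nat else
  if i == 1 then x.2.1 : nat else x.2.2 : nat.
have [|c [[e0 ce0] hc]] := @kernel_exists R E F
    (fun e x => peval (dd (val x.1.1) (ix x) (mono e)) (pt (val x.1.1))).
  rewrite card_ffun !card_prod !card_ord card_sig /b /=.
  rewrite (_ : #|[pred x | x \in J]| = #|J|); last exact: eq_card.
  have M20 : (0 < M ^ 2)%N by rewrite expn_gt0 M0.
  have := JM; rewrite -(ltn_pmul2r M20) -expnS; apply: leq_trans.
  by rewrite ltnS leq_eqVlt /M; apply/orP; left; apply/eqP; ring.
pose Q := \sum_e c e *: mono e.
case/eqP: ce0; have -> : c e0 = mcoeff (Multinom [tuple (e0 i : nat) | i < 3]) Q.
  rewrite /Q raddf_sum (bigD1 e0) //= big1 => [|e ne].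
    by rewrite mcoeffZ mcoeffX eqxx mulr1 addr0.
  rewrite mcoeffZ mcoeffX; case: eqP => [h|_]; last by rewrite mulr0.
  case/eqP: ne; apply/ffunP => i; apply/val_inj.
  by have /mnmP/(_ i) := h; rewrite !mnmE.
suff -> : Q = 0 by rewrite mcoeff0.
apply: (@box_vanishing b (3 * M.-1)%N).
- rewrite /Q; elim/big_ind: _ => [||e _]; first by rewrite /deg_le msize0.
    by move=> x y; apply: deg_leD.
  apply: deg_leZ; rewrite /deg_le msizeX ltnS mdegE.
  have le (i : 'I_3) : (Multinom [tuple (e i : nat) | i < 3] i <= M.-1)%N.
    by rewrite mnmE -ltnS prednK.
  by apply: leq_trans (leq_sum _ (fun i _ => le i)) _; rewrite sum_nat_const card_ord.
- move=> i; rewrite bN; move: M0 S0; case: (M) => // m _; rewrite [m.+1.-1]/=; nia.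
move=> p a pJ ab.
have h0 := ab 0; have h1 := ab 1; have h2 := ab 2%:R.
have := hc ((exist _ p pJ, Ordinal h0), (Ordinal h1, Ordinal h2)).
set x : F := (_, _) => <-.
have -> : dd p a Q = dd p (ix x) Q by [].
rewrite /Q dd_sum peval_sum; apply: eq_bigr => e _.
by rewrite pevalZ.
Qed.

End Key.

(** * Pruning, colouring by components, and the final count *)

(** Removing a class with fewer than N i points loses at most N i - 1 points and one colour of the
    i-th family, so the strict inequality persists and the set stays non-empty. *)
Lemma rich_subset (I : finType) (K N : 'I_3 -> nat) (kappa : forall i, I -> 'I_(K i))
    (J : {set I}) :
  (\sum_i #|[set kappa i p | p in J]%SET| * (N i).-1 < #|J|)%N ->
  exists J' : {set I}, J' != finset.set0 /\ forall i p, p \in J' ->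
    (N i <= #|[set q in J' | kappa i q == kappa i p]%SET|)%N.
Proof.
have [n] := ubnP #|J|; elim: n J => // n IH J Jn hJ.
have J0 : J != finset.set0 by rewrite -card_gt0; apply: leq_ltn_trans hJ.
have [good|] := pselect (forall i p, p \in J ->
    (N i <= #|[set q in J | kappa i q == kappa i p]%SET|)%N); first by exists J.
move=> /existsNP[i /existsNP[p /not_implyP[pJ /negP]]]; rewrite -ltnNge.
set cl := [set q in J | _]%SET => clN.
have clJ : (cl \subset J)%SET by apply/fintype.subsetP => q; rewrite finset.inE => /andP[].
have p_cl : p \in cl by rewrite finset.inE pJ eqxx.
have cl0 : (0 < #|cl|)%N by apply/card_gt0P; exists p.
pose J1 := (J :\: cl)%SET.
have cJ1 : (#|J1| + #|cl| = #|J|)%N by rewrite -(cardsID cl J) (finset.setIidPr clJ) addnC.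
apply: (IH J1); first by move: Jn; rewrite -cJ1; lia.
have J1J : (J1 \subset J)%SET by apply: finset.subsetDl.
have im j : (#|[set kappa j q | q in J1]%SET| <= #|[set kappa j q | q in J]%SET|)%N.
  by apply/subset_leq_card/imsetS.
have imi : (#|[set kappa i q | q in J1]%SET| < #|[set kappa i q | q in J]%SET|)%N.
  apply/proper_card/properP; split; first exact: imsetS.
  exists (kappa i p); first exact: imset_f.
  apply/negP => /imsetP[q]; rewrite !finset.inE => /andP[+ qJ] e.
  by rewrite qJ e eqxx.
move: hJ; rewrite -cJ1 (bigD1 i) //= [X in _ -> (X < _)%N](bigD1 i) //= => hJ.
have sum_le : (\sum_(j < 3 | j != i) #|[set kappa j q | q in J1]%SET| * (N j).-1 <=
    \sum_(j < 3 | j != i) #|[set kappa j q | q in J]%SET| * (N j).-1)%N.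
  by apply: leq_sum => j _; rewrite leq_mul2r im orbT.
have clN' : (#|cl| <= (N i).-1)%N by rewrite -ltnS prednK // (leq_ltn_trans _ clN).
have mi : (#|[set kappa i q | q in J1]%SET| * (N i).-1 + (N i).-1 <=
   #|[set kappa i q | q in J]%SET| * (N i).-1)%N by rewrite addnC -mulSn leq_mul2r imi orbT.
rewrite -(ltn_add2r #|cl|); apply: leq_ltn_trans hJ.
apply: leq_trans (leq_add (leqnn _) clN') _; rewrite addnAC.
exact: leq_add mi sum_le.
Qed.

Lemma size_fibres (T G : eqType) (s : seq T) (h : T -> G) (l : seq G) D :
  (forall x, x \in s -> h x \in l) ->
  (forall g, (size [seq x <- s | h x == g] <= D)%N) -> (size s <= size l * D)%N.
Proof.
elim: l s => [|g l IH] s hl hD /=.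
  by case: s hl {hD} => // x s /(_ x); rewrite mem_head => /(_ isT).
rewrite mulSn -(count_predC (fun x => h x == g)) -!size_filter leq_add //.
apply: IH => [x|g'].
  rewrite mem_filter => /andP[/= ne /hl].
  by rewrite inE (negbTE ne).
apply: leq_trans (hD g'); rewrite -filter_predI !size_filter.
by apply: sub_count => x /andP[].
Qed.

Section Multijoints.
Variables (R : realType) (U : set_system R).
Context {UU : UltraFilter U}.
Hypothesis U0 : 0^'+ `<=` U.
Local Notation R3 := 'rV[R]_3.

Definition tangent_germ (gamma : set R3) (x u : R3) (f : R -> R3) :=
  [/\ f 0 = x, u != 0, right_derivative0 f u & forall s, 0 <= s < 1 -> gamma (f s)].

Lemma tangent_direction_germ gamma x v : tangent_direction gamma x v ->
  exists u f, tangent_germ gamma x u f /\ exists c : R, v = c *: u.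
Proof.
move=> [_ [k [A [N [i [f [u [[Ng _ _ eN] [f0 fA _ _] fu u0 vu]]]]]]]].
exists u, f; split=> //; split=> // s s01; apply: Ng; rewrite eN.
by exists i => //; rewrite -fA; exists s => //=; rewrite in_itv.
Qed.

Definition curve_of_degree_le (D : nat) (gamma : set R3) :=
  exists C Q d, [/\ algebraic_set C, (@complexify R 3) @` gamma `<=` C, (d <= D)%N,
    Q != 0 & section_bound C Q d].

Lemma curve_germ D gamma x u f : curve_of_degree_le D gamma -> tangent_germ gamma x u f ->
  growth (real_germ U f) (D * D).
Proof.
move=> [C [Q [d [Calg gC dD Q0 hsec]]]] [f0 u0 fu fg].
apply: real_germ_growth; apply: (growth_leq (leq_mul dD dD)).
apply: (@uniform_growth _ C Q d hsec Q0 _ [:: complexify u]).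
- exact: germ_ideal_prime.
- exact: complex_germ_zeros fg.
- by move=> v; rewrite inE => /eqP ->; rewrite complexify_eq0.
- move=> a c [_ [_ _ h]]; apply: complex_germ_nconst fu _ => //.
  by apply: h; rewrite inE.
Qed.

Lemma curve_components D gamma k (x u : 'I_k -> R3) (f : 'I_k -> R -> R3) :
  curve_of_degree_le D gamma -> (forall j, tangent_germ gamma (x j) (u j) (f j)) ->
  injective (fun j => complex_germ U (f j)) -> (k <= D)%N.
Proof.
move=> [C [Q [d [Calg gC dD Q0 hsec]]]] hf inj; apply: leq_trans dD.
apply: (@prime_count _ C Q d hsec Q0 k _ (fun j => complexify (u j)) inj).
- by move=> j; apply: germ_ideal_prime.
- by move=> j; have [_ _ _ fg] := hf j; apply: complex_germ_zeros fg.
- by move=> j; have [_ u0 _ _] := hf j; rewrite complexify_eq0.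
- by move=> j a c h; have [_ _ fu _] := hf j; apply: complex_germ_nconst fu h.
Qed.

Variables (D : nat) (Gamma : 'I_3 -> set (set R3)).
Hypotheses (Gfin : forall i, finite_set (Gamma i)) (D0 : (0 < D)%N).
Hypothesis Gdeg : forall i gamma, Gamma i gamma -> curve_of_degree_le D gamma.

Definition spanning_germs (x : R3) (T : 'I_3 -> set R3 * R3 * (R -> R3)) :=
  (forall i, Gamma i (T i).1.1 /\ tangent_germ (T i).1.1 x (T i).1.2 (T i).2) /\
  forall k, exists c : 'I_3 -> R, delta_mx 0 k = \sum_j c j *: (T j).1.2.

(* The colour of a joint is its component of a curve of Gamma i, encoded as the *)
(* pair (curve, germ ideal). *)
Lemma colouring (I : finType) (x : I -> R3) (T : I -> 'I_3 -> set R3 * R3 * (R -> R3)) i :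
  (forall p, spanning_germs (x p) (T p)) ->
  exists K (kappa : I -> 'I_K), (K <= #|` fset_set (Gamma i)| * D)%N /\
    forall p q, kappa p = kappa q -> real_germ U (T p i).2 = real_germ U (T q i).2.
Proof.
move=> hT; pose col p : set R3 * set {mpoly R[i][3]} := ((T p i).1.1, complex_germ U (T p i).2).
pose s := undup [seq col p | p <- enum I].
have in_s p : col p \in s by rewrite mem_undup map_f // mem_enum.
have ks p : (index (col p) s < size s)%N by rewrite index_mem.
exists (size s), (fun p => Ordinal (ks p)); split; last first.
  move=> p q /(congr1 val) /= e; apply: real_germ_eq.
  have : col p = col q by rewrite -(nth_index (col p) (in_s p)) e nth_index.
  by case.
apply: (@size_fibres _ _ _ fst) => [c|g].
  rewrite mem_undup => /mapP[p _ ->] /=; rewrite in_fset_set // inE.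
  by have [/(_ i)[]] := hT p.
set sg := [seq c <- s | _].
(* Over one curve g the colours are distinct germ ideals, at most D of them by
   [curve_components]. *)
have usg : uniq sg by rewrite filter_uniq ?undup_uniq.
have /choice[p hp] : forall j : 'I_(size sg), exists p,
    tnth (in_tuple sg) j = col p /\ (T p i).1.1 = g.
  move=> j; have := mem_tnth j (in_tuple sg); rewrite mem_filter mem_undup.
  by move=> /andP[/eqP eg /mapP[p _ e]]; exists p; split=> //; rewrite -eg e.
have [->|sg0] := posnP (size sg); first by [].
have Gg : Gamma i g by rewrite -(hp (Ordinal sg0)).2; have [/(_ i)[]] := hT (p (Ordinal sg0)).
apply: (@curve_components D g _ (fun j => x (p j)) (fun j => (T (p j) i).1.2)
   (fun j => (T (p j) i).2)) => //; first exact: Gdeg Gg.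
  by move=> j; have [/(_ i)[_]] := hT (p j); rewrite (hp j).2.
move=> j j' e; have ej : tnth (in_tuple sg) j = tnth (in_tuple sg) j'.
  by rewrite (hp j).1 (hp j').1 /col e (hp j).2 (hp j').2.
apply/val_inj/eqP; rewrite -(nth_uniq (col (p j)) _ _ usg) ?ltn_ord //.
by move: ej; rewrite !(tnth_nth (col (p j))) /= => ->.
Qed.

(** The constant collects 4^3 = 64 from n <= 4 K_i N_i, the 27 (D^2)^3 of [key_count] for slope D^2,
    and D^3 from K_i <= |Gamma_i| D. *)
Lemma joint_count (s : seq R3) : uniq s -> (forall x, x \in s -> exists T, spanning_germs x T) ->
  (size s ^ 2 <= 1728 * (D * D) ^ 3 * D ^ 3 * \prod_(i < 3) #|` fset_set (Gamma i)|)%N.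
Proof.
move=> us hs; set n := size s.
have [->|n0] := posnP n; first by [].
pose pt (p : 'I_n) := nth 0 s p.
have ptinj : injective pt.
  by move=> p q /eqP; rewrite /pt nth_uniq ?ltn_ord // => /eqP/val_inj.
have /choice[T hT] : forall p, exists T, spanning_germs (pt p) T.
  by move=> p; apply: hs; apply: mem_nth.
have cK i := colouring i hT.
pose K i := projT1 (cid (cK i)).
pose kappa i := projT1 (cid (projT2 (cid (cK i)))).
have hK i : (K i <= #|` fset_set (Gamma i)| * D)%N.
  by have [] := projT2 (cid (projT2 (cid (cK i)))).
have hk i p q : kappa i p = kappa i q -> real_germ U (T p i).2 = real_germ U (T q i).2.
  by have [_] := projT2 (cid (projT2 (cid (cK i)))); apply.
have K0 i : (0 < K i)%N by apply: leq_ltn_trans (ltn_ord (kappa i (Ordinal n0))).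
(* Pruning then costs at most n / 4 points for each of the three families, so some joints
   survive. *)
pose N i := (n %/ (4 * K i)).+1.
have KN i : (n <= 4 * K i * N i)%N.
  by rewrite /N mulnC ltnW // ltn_ceil // muln_gt0 K0.
have [|J [J0 rich]] := @rich_subset 'I_n K N kappa [set: 'I_n]%SET.
  rewrite cardsT card_ord.
  have le i : (#|[set kappa i p | p in [set: 'I_n]]%SET| * (N i).-1 <= n %/ 4)%N.
    apply: (@leq_trans (K i * (n %/ (4 * K i)))).
      by rewrite leq_mul2r; apply/orP; right; apply: leq_trans (max_card _) _; rewrite card_ord.
    by rewrite divnMA mulnC leq_trunc_div.
  apply: leq_ltn_trans (leq_sum _ (fun i _ => le i)) _.
  rewrite sum_nat_const card_ord.
  by have := leq_trunc_div n 4; move: n0; lia.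
have key : (N 0%R * N 1%R * N 2%:R%R <= 27 * (D * D) ^ 3 * #|J|)%N.
  apply: (@key_count R U UU U0 'I_n pt (D * D) (fun i p => (T p i).2)
    (fun i p => (T p i).1.2)) => //.
  - by rewrite muln_gt0 D0.
  - by move=> i p; have [/(_ i)[_ []]] := hT p.
  - by move=> i p; have [/(_ i)[_ []]] := hT p.
  - by move=> i p; have [/(_ i)[_ []]] := hT p.
  - by move=> p k; have [_] := hT p; apply.
  - by move=> i p; have [/(_ i)[/Gdeg hg tg] _] := hT p; apply: curve_germ hg tg.
  move=> i p pJ; apply: leq_trans (rich i p pJ) _; apply/subset_leq_card.
  apply/fintype.subsetP => q; rewrite !finset.inE => /andP[-> /eqP e] /=.
  by apply/asboolP/hk.
have n3 : (n ^ 3 <= 64 * (K 0%R * K 1%R * K 2%:R%R) * (N 0%R * N 1%R * N 2%:R%R))%N.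
  have := leq_mul (leq_mul (KN 0) (KN 1)) (KN 2%:R).
  rewrite (_ : (n * n * n = n ^ 3)%N); last by ring.
  by move/leq_trans; apply; rewrite leq_eqVlt; apply/orP; left; apply/eqP; ring.
rewrite -(leq_pmul2r n0) -expnSr; apply: leq_trans n3 _.
have Jn : (#|J| <= n)%N by rewrite -[n in (_ <= n)%N]card_ord max_card.
apply: leq_trans (leq_mul (leq_mul (leqnn 64) (leq_mul (leq_mul (hK 0) (hK 1)) (hK 2%:R)))
  (leq_trans key (leq_mul (leqnn _) Jn))) _.
rewrite !big_ord_recl big_ord0 muln1.
rewrite (_ : lift ord0 (lift ord0 ord0) = 2%:R); last exact: val_inj.
rewrite (_ : lift ord0 ord0 = 1); last exact: val_inj.
rewrite (_ : ord0 = 0); last exact: val_inj.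
by rewrite leq_eqVlt; apply/orP; left; apply/eqP; ring.
Qed.

End Multijoints.

Lemma bounded_finite_set (T : choiceType) (J : set T) B :
  (forall s : seq T, uniq s -> (forall x, x \in s -> J x) -> (size s <= B)%N) -> finite_set J.
Proof.
move=> bd; pose Q m := `[< exists s : seq T, [/\ uniq s, forall x, x \in s -> J x & size s = m] >].
have Q0 : exists m, Q m by exists 0%N; apply/asboolP; exists [::].
have QB m : Q m -> (m <= B)%N by move=> /asboolP[s [us sJ <-]]; apply: bd.
have [m /asboolP[s [us sJ sm]] mmax] := ex_maxnP Q0 QB.
rewrite (_ : J = [set` s]); first exact: finite_seq.
apply/seteqP; split=> x /=; last exact: sJ.
move=> Jx; apply: contrapT => /negP xs.
suff /mmax : Q (size s).+1 by rewrite -sm ltnn.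
apply/asboolP; exists (x :: s); split=> //=; first by rewrite xs.
by move=> y; rewrite inE => /orP[/eqP->|/sJ].
Qed.

Lemma span_coords (R : fieldType) (u v : 'I_3 -> 'rV[R]_3) :
  <<[:: v 0%R; v 1%R; v 2%:R%R]>>%VS = fullv -> (forall i, exists c : R, v i = c *: u i) ->
  forall k, exists c : 'I_3 -> R, delta_mx 0 k = \sum_j c j *: u j.
Proof.
move=> span /choice[c hc] k.
have := coord_span (X := in_tuple [:: v 0; v 1; v 2%:R]) (v := delta_mx 0 k).
rewrite /= span memvf => /(_ isT) ->.
exists (fun j => coord (in_tuple [:: v 0; v 1; v 2%:R]) j (delta_mx 0 k) * c j).
apply: eq_bigr => j _; rewrite -scalerA -hc; congr (_ *: _).
by case: j => -[|[|[|//]]] h /=; congr v; apply/val_inj.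
Qed.

Theorem theorem6p2p2 (R : realType) (b : R) (hb : 0 < b) :
  exists c_b : R,
    forall Gamma1 Gamma2 Gamma3 : set (set 'rV[R]_3),
      finite_set Gamma1 -> finite_set Gamma2 -> finite_set Gamma3 ->
      (forall gamma, (Gamma1 `|` Gamma2 `|` Gamma3) gamma ->
         algebraic_curve gamma /\
         exists2 d : nat, real_degree gamma d & d%:R <= b) ->
      let J := [set x | multijoint Gamma1 Gamma2 Gamma3 x] in
      finite_set J /\
      (#|` fset_set J|)%:R <=
        c_b * Num.sqrt ((#|` fset_set Gamma1| * #|` fset_set Gamma2|
                         * #|` fset_set Gamma3|)%N%:R).
Proof.
pose D := Num.bound b.
have bD : b < D%:R by apply/archi_boundP/ltW.
have D0 : (0 < D)%N by rewrite -(ltr_nat R) (lt_trans hb).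
pose A := (1728 * (D * D) ^ 3 * D ^ 3)%N.
exists (Num.sqrt A%:R) => G1 G2 G3 f1 f2 f3 hG J.
pose G (i : 'I_3) := if i == 0 then G1 else if i == 1 then G2 else G3.
have Gfin i : finite_set (G i) by rewrite /G; case: ifP => // _; case: ifP.
have GU i gamma : G i gamma -> (G1 `|` G2 `|` G3) gamma.
  by rewrite /G; case: ifP => [_ ?|_]; [left; left|case: ifP => _ ?; [left; right|right]].
have Gdeg i gamma : G i gamma -> curve_of_degree_le D gamma.
  move=> /GU/hG[_ [d [C [[Calg _] sub _] Cd] db]].
  have [Q Q0 hsec] := section_bound_of_degree Cd.
  exists C, Q, d; split=> //; rewrite -ltnS -(ltr_nat R).
  by apply: le_lt_trans db (lt_trans bD _); rewrite ltr_nat.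
(* One ultrafilter serves all arcs, so that their germ ideals can be compared. *)
have [U [UU U0]] := ultraFilterLemma (at_right_proper_filter (0 : R)).
have Jgerm x : J x -> exists T, spanning_germs G x T.
  move=> [_ _ _ [v1 [v2 [v3 [t1 t2 t3 span]]]]].
  pose v (i : 'I_3) := if i == 0 then v1 else if i == 1 then v2 else v3.
  have tv i : exists T : set 'rV[R]_3 * 'rV[R]_3 * (R -> 'rV[R]_3),
      [/\ G i T.1.1, tangent_germ T.1.1 x T.1.2 T.2 & exists c, v i = c *: T.1.2].
    have : tangent_directions (G i) x (v i).
      by rewrite /G /v; case: ifP => // _; case: ifP.
    move=> [gamma [Ggamma _ /tangent_direction_germ[u [f [tg uv]]]]].
    by exists (gamma, u, f).
  have /choice[T hT] := tv; exists T; split=> [i|]; first by have [] := hT i.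
  apply: (@span_coords _ _ v) => [|i]; last by have [] := hT i.
  by rewrite -span.
have count s : uniq s -> (forall x, x \in s -> J x) ->
    (size s ^ 2 <= A * (#|` fset_set G1| * #|` fset_set G2| * #|` fset_set G3|))%N.
  move=> us sJ.
  have := @joint_count _ _ UU U0 _ _ Gfin D0 Gdeg _ us (fun x xs => Jgerm x (sJ x xs)).
  by rewrite !big_ord_recl big_ord0 muln1 [X in (_ <= _ * X)%N]mulnA.
have Jfin : finite_set J.
  (* The bound on the square of the number of joints also bounds the number itself. *)
  apply: bounded_finite_set => s us sJ; apply: leq_trans (count s us sJ).
  by case: (size s) => // n; rewrite -mulnn leq_pmulr.
split=> //.
have cJ : (#|` fset_set J| ^ 2 <=
    A * (#|` fset_set G1| * #|` fset_set G2| * #|` fset_set G3|))%N.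
  apply: (count (enum_fset (fset_set J))); first exact: fset_uniq.
  by move=> x; rewrite in_fset_set // inE.
rewrite -sqrtrM ?ler0n // -natrM -[leLHS]ger0_norm ?ler0n // -sqrtr_sqr.
by rewrite ler_wsqrtr // -natrX ler_nat.
Qed.
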